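(* Let $1\le d\le n$, let $w,\tau\in S_n/(S_d\times S_{n-d})$ with $\tau\le w$, and identify $w$ with $(i_1,\dots,i_d)$ and $\tau$ with $(j_1,\dots,j_d)$, where $i_1<\dots<i_d$ and $j_1<\dots<j_d$. Then the following two statements are equivalent. (i) (Conjecture of Kreiman and Lakshmibai.) For every $m\ge0$, the dimension $h_{TC_\tau X(w)}(m)$ of the $m$-th homogeneous component of (the coordinate ring of) the tangent cone to $X(w)$ at $\tau$ is equal to the number of multisets of cardinality $m$ of reflections $(x,y)$, $1\le x\le d$, $d+1\le y\le n$, which satisfy (S1). (ii) The Hilbert series $\sum_{m\ge0}h_{TC_\tau X(w)}(m)\,z^m$ of the tangent cone to $X(w)$ at $\tau$ is equal to $$\frac{\displaystyle\sum_{\mathbf P\in \mathbb P^+(\mathbf A\to\mathbf E)} z^{\operatorname{EN}(\mathbf P)}}{(1-z)^{\sum_{\ell=1}^d i_\ell-\binom{d+1}{2}}},$$ where $A_\ell=(d+1-\ell,d)$ and $E_\ell=(d-\kappa_\ell,\kappa_\ell+i_\ell)$ for $\ell=1,\dots,d$, with $\kappa_q=|\{\ell: i_q<j_\ell\}|$.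
   Context: $V$ is an $n$-dimensional vector space over an algebraically closed field of arbitrary characteristic, and $\mathrm{Gr}_d(V)$ is the Grassmannian of $d$-dimensional subspaces of $V$. Each coset in $S_n/(S_d\times S_{n-d})$ has a unique minimal representative $i_1i_2\dots i_n$ (one-line notation) with $i_1<\dots<i_d$ and $i_{d+1}<\dots<i_n$; the coset is identified with this permutation and with $(i_1,\dots,i_d)$. The Bruhat order on $S_n$ induces the order on cosets: $(j_1,\dots,j_d)\le(i_1,\dots,i_d)$ iff $j_\ell\le i_\ell$ for all $\ell$. With respect to a fixed complete flag $V_1\subset\dots\subset V_n=V$ ($\dim V_m=m$), $X(w)=\{U\in \mathrm{Gr}_d(V):\dim(U\cap V_{i_\ell})\ge \ell,\ 1\le \ell\le d\}$ is the Schubert variety of $w$. It is the disjoint union of Schubert cells indexed by the $\tau=(j_1,\dots,j_d)\le w$, the cell of $\tau$ being $\{U:\dim(U\cap V_m)=|\{\ell:j_\ell\le m\}|\text{ for all }m\}$. ''At $\tau$'' means at a point of the cell of $\tau$. The tangent cone at a point with local ring $(\mathcal O,\mathfrak m)$ has coordinate ring $\bigoplus_{m\ge0}\mathfrak m^m/\mathfrak m^{m+1}$. Property (S1) of a multiset $S$ of reflections: every chain $s_1>s_2>\dots>s_t$ of pairwise commuting reflections, all contained in $S$, satisfies $w\ge\tau s_1\cdots s_t$ in the induced Bruhat order on $S_n/(S_d\times S_{n-d})$. Here $\tau$ is the minimal representative viewed as a permutation, $(\tau s)(x)=\tau(s(x))$, and the product is compared with $w$ through its coset, i.e. via the increasing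 rearrangement of its values at $1,\dots,d$. The order of reflections is the Bruhat order; for pairwise commuting distinct reflections $s_\ell=(x_\ell,y_\ell)$ with $x_\ell\le d<y_\ell$ it means $x_1<\dots<x_t$ and $y_1>\dots>y_t$. Lattice paths are paths in $\mathbb Z^2$ consisting of unit horizontal and vertical steps in the positive direction (a path may have length zero). A family of paths is nonintersecting if no two of its paths share a lattice point. $\mathbb P^+(\mathbf A\to\mathbf E)$ denotes the set of all families $\mathbf P=(P_1,\dots,P_d)$ of nonintersecting lattice paths where $P_\ell$ runs from $A_\ell$ to $E_{\sigma(\ell)}$, $\ell=1,\dots,d$, for some permutation $\sigma\in S_d$ (for given $w,\tau$ this permutation is the same for all such families). An EN-turn of a lattice path $P$ is a point of $P$ which is the end point of a horizontal step and at the same time the starting point of a vertical step; $\operatorname{EN}(P)$ is the number of EN-turns of $P$, and $\operatorname{EN}(\mathbf P)=\sum_{\ell=1}^d\operatorname{EN}(P_\ell)$. *)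

(* Defs.v *)
From HB Require Import structures.
From mathcomp Require Import all_boot all_order all_fingroup all_algebra.
From mathcomp Require Import mpoly.
From mathcomp Require Import boolp classical_sets functions.

Set Implicit Arguments.
Unset Strict Implicit.
Unset Printing Implicit Defensive.

Import GRing.Theory.

Local Open Scope ring_scope.

Section HilbertFunction.
Variables (O : comNzRingType) (I : set O).

Fixpoint ideal_pow (k : nat) : set O :=
  if k is k'.+1 then
    [set a | exists s : seq (O * O),
       (forall p, p \in s -> I p.1 /\ ideal_pow k' p.2) /\
       a = \sum_(p <- s) p.1 * p.2]
  else setT.

(* [e] induces a basis of the vector space I^k/I^(k+1) over the field O/I. *)
Definition graded_basis (k r : nat) (e : 'I_r -> O) : Prop :=
  [/\ forall i, ideal_pow k (e i),
      forall a, ideal_pow k a ->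
        exists c : 'I_r -> O, ideal_pow k.+1 (a - \sum_i c i * e i)
    & forall c : 'I_r -> O, ideal_pow k.+1 (\sum_i c i * e i) ->
        forall i, I (c i)].

(* The dimension of I^k/I^(k+1) over O/I; it is finite, hence the default
   value 0 is not used, as soon as O is noetherian and I is maximal. *)
Definition hilbert_fun (k : nat) : nat :=
  xget 0%N [set r | exists e : 'I_r -> O, graded_basis k e].

End HilbertFunction.

(* X is a set of points of T, and [phi y] are homogeneous coordinates of the
   point y, so that X is viewed as a subset of a projective space, with its
   Zariski topology and reduced structure. *)
Section LocalRing.
Variables (K : fieldType) (T : pointedType) (N : nat).
Variables (phi : T -> 'I_N -> K) (X : set T) (x : T).

(* The nonvanishing loci in X of homogeneous polynomials h with h(x) <> 0 form
   a basis of the neighbourhoods of x in X. *)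
Definition regular_at : {pred T -> K} := fun f =>
  `[< exists (e : nat) (g h : {mpoly K[N]}),
      [/\ g \is e.-homog, h \is e.-homog, h.@[phi x] != 0
        & forall y, X y -> h.@[phi y] != 0 -> f y = g.@[phi y] / h.@[phi y]] >].

Fact regular_at_subring : subring_closed regular_at.
Proof.
split.
- apply/asboolP; exists 0%N, 1, 1; split; rewrite ?dhomog1 ?meval1 ?oner_eq0 //.
  by move=> y _ _; rewrite meval1 divr1.
- move=> f1 f2 /asboolP[e1 [g1 [h1 [Hg1 Hh1 n1 E1]]]].
  move=> /asboolP[e2 [g2 [h2 [Hg2 Hh2 n2 E2]]]].
  apply/asboolP; exists (e1 + e2)%N, (g1 * h2 - g2 * h1), (h1 * h2); split.
  + by apply: rpredB; [|rewrite addnC]; apply: dhomogM.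
  + exact: dhomogM.
  + by rewrite mevalM mulf_neq0.
  + move=> y Xy; rewrite mevalM mulf_eq0 negb_or => /andP[m1 m2].
    by rewrite mevalB !mevalM -mulNr -addf_div // mulNr -E1 // -E2.
- move=> f1 f2 /asboolP[e1 [g1 [h1 [Hg1 Hh1 n1 E1]]]].
  move=> /asboolP[e2 [g2 [h2 [Hg2 Hh2 n2 E2]]]].
  apply/asboolP; exists (e1 + e2)%N, (g1 * g2), (h1 * h2); split.
  + exact: dhomogM.
  + exact: dhomogM.
  + by rewrite mevalM mulf_neq0.
  + move=> y Xy; rewrite mevalM mulf_eq0 negb_or => /andP[m1 m2].
    by rewrite mevalM -mulf_div -E1 // -E2.
Qed.

HB.instance Definition _ :=
  GRing.isSubringClosed.Build (T -> K) regular_at regular_at_subring.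

Record regular_fun := RegularFun {
  regular_val :> T -> K;
  regular_valP : regular_val \in regular_at
}.

HB.instance Definition _ := [isSub for regular_val].
HB.instance Definition _ := [Choice of regular_fun by <:].
HB.instance Definition _ :=
  [SubChoice_isSubComNzRing of regular_fun by <:].

(* Two regular functions have the same germ at x when their difference vanishes
   on a neighbourhood of x in X. *)
Definition null_at : {pred regular_fun} := fun f =>
  `[< exists (e : nat) (h : {mpoly K[N]}),
      [/\ h \is e.-homog, h.@[phi x] != 0
        & forall y, X y -> h.@[phi y] != 0 -> f y = 0] >].

Hypothesis Xx : X x.

Fact null_at_idealr : idealr_closed null_at.
Proof.
split.
- by apply/asboolP; exists 0%N, 1; split; rewrite ?dhomog1 ?meval1 ?oner_eq0.
- apply/negP => /asboolP[e [h [_ hx /(_ x Xx hx) /eqP]]].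
  by rewrite -[_ x]/(1 : K) oner_eq0.
- move=> a f1 f2 /asboolP[e1 [h1 [Hh1 n1 E1]]] /asboolP[e2 [h2 [Hh2 n2 E2]]].
  apply/asboolP; exists (e1 + e2)%N, (h1 * h2); split.
  + exact: dhomogM.
  + by rewrite mevalM mulf_neq0.
  + move=> y Xy; rewrite mevalM mulf_eq0 negb_or => /andP[m1 m2].
    by rewrite -[LHS]/(a y * f1 y + f2 y) E1 // E2 // mulr0 addr0.
Qed.

HB.instance Definition _ := isIdealr.Build regular_fun null_at null_at_idealr.

Definition local_ring : comNzRingType := {ideal_quot null_at}.

Definition germ (f : regular_fun) : local_ring := (\pi_(local_ring) f)%qT.

Definition max_ideal : set local_ring := [set germ f | f in [set f : regular_fun | f x = 0]].

End LocalRing.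

Arguments local_ring {K T N} phi {X x} Xx.
Arguments max_ideal {K T N} phi {X x} Xx.

(* Points are numbered from 0 in ['I_n] and from 1 in the mathematics: x <= d
   reads x < d, and the value of u at x is (u x).+1. *)
Section Cosets.
Variables (n d : nat).

(* u is the minimal representative of its class in S_n/(S_d x S_(n-d)). *)
Definition min_rep (u : 'S_n) : bool :=
  [forall x : 'I_n, forall y : 'I_n,
     (x < y)%N && ((y < d) || (d <= x))%N ==> (u x < u y)%N].

(* The (l+1)-st smallest of the values, in 1..n, of u at 1, .., d. *)
Definition coset_val (u : 'S_n) (l : nat) : nat :=
  nth 0%N (sort leq [seq (u x).+1 | x : 'I_n <- enum 'I_n & (x < d)%N]) l.

Definition coset_le (u v : 'S_n) : bool :=
  [forall l : 'I_d, (coset_val u l <= coset_val v l)%N].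

End Cosets.

Section Bruhat.
Variable n : nat.

(* Right multiplication by a transposition that increases the length; in
   MathComp (s * u) z = u (s z). *)
Definition bruhat_step (u v : 'S_n) : bool :=
  [exists x : 'I_n, exists y : 'I_n,
     [&& (x < y)%N, (u x < u y)%N & v == (tperm x y * u)%g]].

Definition bruhat_le : rel 'S_n := connect bruhat_step.

Definition bruhat_lt (u v : 'S_n) : bool := (u != v) && bruhat_le u v.

End Bruhat.

Section Grassmannian.
Variables (K : fieldType) (V : vectType K).

HB.instance Definition _ := isPointed.Build {vspace V} 0%VS.

Definition plucker_idx (d : nat) : {set d.-tuple 'I_(\dim {:V})} :=
  [set t : d.-tuple _ | sorted ltn [seq val i | i <- t]].

(* The maximal minors of the matrix of a basis of U; another basis multiplies
   all of them by the same nonzero scalar. *)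
Definition plucker (d : nat) (U : {vspace V}) (k : 'I_#|plucker_idx d|) : K :=
  \det (\matrix_(a < d, b < d)
    coord (vbasis {:V}) (tnth (enum_val k) b) (vbasis U)`_a).

Definition complete_flag (n : nat) (F : nat -> {vspace V}) : Prop :=
  (forall m, (0 < m <= n)%N -> \dim (F m) = m) /\
  (forall m, (0 < m < n)%N -> (F m <= F m.+1)%VS).

Variables (n : nat) (F : nat -> {vspace V}) (d : nat).

Definition schubert_variety (w : 'S_n) : set {vspace V} :=
  [set U | \dim U = d /\
    forall l : 'I_d, (l.+1 <= \dim (U :&: F (coset_val d w l)))%N].

Definition schubert_cell (tau : 'S_n) : set {vspace V} :=
  [set U | \dim U = d /\
    forall m, (0 < m <= n)%N ->
      \dim (U :&: F m) = #|[set l : 'I_d | (coset_val d tau l <= m)%N]|].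

Definition tangent_cone_hilbert (w : 'S_n) (U : {vspace V})
    (XU : schubert_variety w U) : nat -> nat :=
  hilbert_fun (max_ideal (@plucker d) XU).

End Grassmannian.

Section Reflections.
Variables (n d : nat).

Definition reflection : predArgType :=
  {s : 'I_n * 'I_n | (s.1 < d)%N && (d <= s.2)%N}.

Definition refl_perm (s : reflection) : 'S_n := tperm (val s).1 (val s).2.

(* tau o s_1 o .. o s_t, where MathComp writes f o g as g * f. *)
Definition mul_chain (tau : 'S_n) (c : seq reflection) : 'S_n :=
  foldl (fun u s => refl_perm s * u)%g tau c.

Definition S1 (w tau : 'S_n) (S : pred reflection) : Prop :=
  forall c : seq reflection,
    sorted (fun s s' => bruhat_lt (refl_perm s') (refl_perm s)) c ->
    {in c &, forall s s', commute (refl_perm s) (refl_perm s')} ->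
    {in c, forall s, S s} ->
    coset_le d (mul_chain tau c) w.

(* A multiset of cardinality m is given by its multiplicities, which are at
   most m. *)
Definition S1_multisets (w tau : 'S_n) (m : nat) :
    {set {ffun reflection -> 'I_m.+1}} :=
  [set M : {ffun reflection -> 'I_m.+1} |
     (\sum_s M s == m)%N && `[< S1 w tau (fun s => 0 < M s)%N >]].

End Reflections.

(* A path is given by its starting point and its word of steps, [false] for a
   horizontal and [true] for a vertical step. *)
Definition lattice_step (p : int * int) (up : bool) : int * int :=
  if up then (p.1, p.2 + 1) else (p.1 + 1, p.2).

Definition path_points (p : int * int) (s : seq bool) : seq (int * int) :=
  p :: scanl lattice_step p s.

Definition path_end (p : int * int) (s : seq bool) : int * int :=
  foldl lattice_step p s.

Definition EN (s : seq bool) : nat :=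
  count (fun k => ~~ nth true s k && nth false s k.+1) (iota 0 (size s)).

Section PathFamilies.
Variables (n d : nat) (w tau : 'S_n).

Definition kappa (q : 'I_d) : nat :=
  #|[set l : 'I_d | (coset_val d w q < coset_val d tau l)%N]|.

Definition startA (l : 'I_d) : int * int := (d.+1%:Z - l.+1%:Z, d%:Z).

Definition endE (l : 'I_d) : int * int :=
  (d%:Z - (kappa l)%:Z, (kappa l)%:Z + (coset_val d w l)%:Z).

(* All paths from A_l to E_k have i_k + l - 1 - d < n steps (l counted from 1),
   so the bound n on the length of words is no restriction. *)
Definition path_families : {set {ffun 'I_d -> n.-bseq bool}} :=
  [set P : {ffun 'I_d -> n.-bseq bool} |
           [exists sigma : 'S_d, forall l : 'I_d,
              path_end (startA l) (P l) == endE (sigma l)]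
         & [forall l : 'I_d, forall k : 'I_d, (l != k) ==>
              ~~ has (mem (path_points (startA l) (P l)))
                     (path_points (startA k) (P k))]].

Definition EN_family (P : {ffun 'I_d -> n.-bseq bool}) : nat :=
  (\sum_l EN (P l))%N.

Definition EN_poly : {poly int} :=
  \sum_(P in path_families) 'X^(EN_family P).

End PathFamilies.

(* \sum_m h(m) z^m = num / den in the ring of formal power series, for den with
   constant term 1, written as (\sum_m h(m) z^m) * den = num. *)
Definition hilbert_series_eq (h : nat -> nat) (num den : {poly int}) : Prop :=
  forall m : nat, \sum_(k < m.+1) (h k)%:Z * den`_(m - k) = num`_m.

(* Main.v *)
Require Import Defs.
From HB Require Import structures.
From mathcomp Require Import all_boot all_order all_fingroup all_algebra.
From mathcomp Require Import mpoly zify.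
From mathcomp Require Import boolp classical_sets functions.

(** Both sides are statements about the same power series, so the theorem
    amounts to computing the generating function of the multisets that satisfy
    (S1), whatever the Hilbert function of the tangent cone is.

    Put a m = |{x <= d : tau(x) <= m}| and r m = |{x <= d : w(x) <= m}|.  Then
    (S1) says that, for all m, the set S has no more than a m - r m elements in
    a chain with x increasing and y decreasing inside the rectangle
    {x <= a m} x {y > d + m - a m}, whose lower right corner is a point of the
    lattice path from (0,d) to (d,n) with m-th step horizontal iff m is one of
    the j's.  The corners with m = i_l are exactly the end points E_l.

    For a family P of nonintersecting paths let F(P) be the set of its points
    other than the starting points and R(P) the set of its EN-turns.  The sets
    S with (S1) are partitioned by the intervals [R(P), F(P)]: each such S lies
    in exactly one of them.  As |F(P)| does not depend on P, summing
    z^|R(P)| / (1-z)^|F(P)| over P gives the formula.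

    Only paths that meet a rectangle and end outside contribute to its chains,
    which gives the bound on chains in F(P).  Conversely P is recovered from S
    row by row, from below: in each row a path advances to the last point of S
    or end point before the next path.  This process is blocked only if a point
    of S has no path to its left, and tracing back the paths that moved away
    then exhibits a chain that is too long. *)

Set Implicit Arguments.
Unset Strict Implicit.
Unset Printing Implicit Defensive.

(** * The row process *)

Lemma iota0Sr x : iota 0 x.+1 = iota 0 x ++ [:: x].
Proof. by rewrite -addn1 iotaD. Qed.

Section RowProcess.
Variable d : nat.

(* In a fixed row, [e] marks the columns in which a path arrives from below and
   [p] the points to be visited.  A path goes from x to x + 1 iff some point of
   [p] lies to the right of x and before the next arriving path. *)
Fixpoint hor_rec (e p : pred nat) (k x : nat) : bool :=
  if k is k'.+1 then ~~ e x.+1 && (p x.+1 || hor_rec e p k' x.+1) else false.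

Definition hor (e p : pred nat) (x : nat) : bool := hor_rec e p (d.-1 - x) x.

Lemma horE e p x :
  hor e p x = [&& x.+1 < d, ~~ e x.+1 & p x.+1 || hor e p x.+1].
Proof.
rewrite /hor; case: (ltnP x.+1 d) => h.
  by have -> : d.-1 - x = (d.-1 - x.+1).+1 by lia.
by have -> : d.-1 - x = 0 by lia.
Qed.

Definition occupied (e p : pred nat) (x : nat) : bool :=
  e x || (0 < x) && hor e p x.-1.

Lemma hor_witness e p x : hor e p x ->
  exists z, [/\ x < z < d, p z & forall x', x < x' <= z -> ~~ e x'].
Proof.
move: {2}(d - x) (leqnn (d - x)) => k; elim: k x => [|k IH] x hk.
  by rewrite horE; case: ltnP => //; lia.
rewrite horE => /and3P[xd ex /orP[px|/IH]].
- exists x.+1; split=> // [|x' hx']; first lia.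
  by have -> : x' = x.+1 by lia.
case=> [|z [hz pz ez]]; first lia.
exists z; split=> // [|x' hx']; first lia.
by case: (eqVneq x' x.+1) => [->//|ne]; apply: ez; lia.
Qed.

(** Where nothing arrives from below, the definition of [hor] brings a path in from the left; the
    hypothesis takes care of column 0. *)
Lemma occupied_hor e p x : (p 0 || hor e p 0 -> e 0) -> x < d ->
  p x || hor e p x -> occupied e p x.
Proof.
case: x => [|x] h xd; rewrite /occupied ?orbF //.
case: (boolP (e x.+1)) => //= ne H; by rewrite horE xd ne H.
Qed.

(* Conservation of paths on the points 0, .., x - 1 of a row in which the paths
   at the points of [q] end. *)
Lemma flow (e p q : pred nat) x :
  (p 0 || hor e p 0 -> e 0) -> (forall x, q x -> p x) ->
  (forall x, q x -> ~~ hor e p x) -> x <= d ->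
  count e (iota 0 x) =
  count (fun z => [&& occupied e p z, ~~ hor e p z & ~~ q z]) (iota 0 x)
  + count q (iota 0 x) + ((0 < x) && hor e p x.-1).
Proof.
move=> h0 qp qh; elim: x => [|x IH] xd //.
rewrite iota0Sr !count_cat (IH (ltnW xd)) /= !addn0.
have := @occupied_hor e p x h0 xd; have := qp x; have := qh x.
rewrite /occupied; have := horE e p x.-1.
case: x {IH} xd => [|x] /= xd; rewrite ?xd /= ?orbF.
  by case: (e 0); case: (p 0); case: (hor e p 0); case: (q 0) => //= *; lia.
case: (hor e p x); case: (e x.+1); case: (p x.+1); case: (hor e p x.+1);
  case: (q x.+1) => //= *; lia.
Qed.
End RowProcess.

(** For points of reflections: the later pair is nested strictly inside the earlier one. *)
Definition chain_rel : rel (nat * nat) :=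
  fun z z' => (z.1 < z'.1) && (z'.2 < z.2).

Lemma chain_rel_trans : transitive chain_rel.
Proof. by move=> y x t /andP[? ?] /andP[? ?]; apply/andP; lia. Qed.

(** * The boundary path, its corners and the end points *)

Section Boundary.
Variables (d : nat) (a r : nat -> nat).

(* The m-th rectangle consists of the points (x, y) with x < a m and
   y >= ht m. *)
Definition ht (m : nat) : nat := d + m - a m.

(* (x, y) is the end point E_l with i_l = m + 1. *)
Definition sink (y x : nat) : bool :=
  let m := x + y + 1 - d in
  [&& r m < r m.+1, a m.+1 == x.+1 & ht m.+1 == y.+1].

(** The region below and to the right of the boundary path with corners (a m, ht m). *)
Definition right_of (y x : nat) : Prop := exists m, a m <= x /\ y < ht m.

Hypothesis a0 : a 0 = 0.
Hypothesis aS : forall m, a m <= a m.+1 <= (a m).+1.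

Lemma a_le m : a m <= m.
Proof. by elim: m => [|m IH]; [rewrite a0|have := aS m; lia]. Qed.

Lemma a_ht m : a m + ht m = d + m.
Proof. by rewrite /ht; have := a_le m; lia. Qed.

Lemma ht_ge m : d <= ht m.
Proof. by rewrite /ht; have := a_le m; lia. Qed.

Lemma a_mono m k : m <= k -> a m <= a k.
Proof.
move=> mk; rewrite -(subnKC mk); elim: (k - m) => [|j IH]; first by rewrite addn0.
by rewrite addnS; have := aS (m + j); lia.
Qed.

Lemma ht_mono m k : m <= k -> ht m <= ht k.
Proof.
move=> mk; rewrite -(subnKC mk); elim: (k - m) => [|j IH]; first by rewrite addn0.
by rewrite addnS; have := aS (m + j); have := a_ht (m + j); have := a_ht (m + j).+1; lia.
Qed.

Lemma sinkP y x : reflect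
  (exists m, [/\ r m < r m.+1, a m.+1 = x.+1 & ht m.+1 = y.+1]) (sink y x).
Proof.
apply: (iffP and3P) => [[h /eqP h1 /eqP h2]|[m [h1 h2 h3]]].
  by eexists; split; eauto.
have -> : x + y + 1 - d = m by have := a_ht m.+1; lia.
by rewrite h1 h2 h3.
Qed.

Lemma a_reach x m : x <= a m -> exists k, k <= m /\ a k = x.
Proof.
elim: m => [|m IH] h; first by exists 0; split=> //; move: h; rewrite a0; lia.
case: (leqP x (a m)) => [/IH [k [? ?]]|?]; first by exists k; split=> //; lia.
by exists m.+1; split=> //; have := aS m; lia.
Qed.
(** Meant for k with [r k < r k.+1]: then [a k.+1 >= r k.+1 > 0], and the predecessors are
    genuine. *)
Definition sink_pt (k : nat) : nat * nat := ((a k.+1).-1, (ht k.+1).-1).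

Hypothesis ra : forall m, r m <= a m.
Hypothesis d_gt0 : 0 < d.

Lemma sink_sink_pt k : r k < r k.+1 -> sink (sink_pt k).2 (sink_pt k).1.
Proof.
move=> h; apply/sinkP; exists k; split=> //=; first by have := ra k.+1; lia.
by rewrite prednK // (leq_trans d_gt0 (ht_ge _)).
Qed.
End Boundary.

(** * The row-by-row construction is never blocked *)

Section Construction.
Variables (d : nat) (a r : nat -> nat) (g : nat -> pred nat).

Local Notation ht := (ht d a).
Local Notation sink := (sink d a r).
Local Notation right_of := (right_of d a).

Definition mark (y x : nat) : bool := g y x || sink y x.

(* [vert y x]: a path uses the edge from (x, y - 1) to (x, y).  The paths start
   in row d - 1, where they are made to arrive from below in every column. *)
Fixpoint vert (y x : nat) : bool :=
  if y is y'.+1 then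
    if y < d then x < d else
    [&& occupied d (vert y') (mark y') x, ~~ hor d (vert y') (mark y') x
      & ~~ sink y' x]
  else x < d.

Definition horiz (y : nat) : pred nat := hor d (vert y) (mark y).

Definition occ (y : nat) : pred nat := occupied d (vert y) (mark y).

Hypothesis d_gt0 : 0 < d.
Hypothesis a0 : a 0 = 0.
Hypothesis aS : forall m, a m <= a m.+1 <= (a m).+1.
Hypothesis aD : exists n, a n = d.
Hypothesis a_le_d : forall m, a m <= d.
Hypothesis r0 : r 0 = 0.
Hypothesis rS : forall m, r m <= r m.+1 <= (r m).+1.
Hypothesis ra : forall m, r m <= a m.
Hypothesis g_chain : forall m c, sorted chain_rel c ->
  all (fun z => [&& g z.2 z.1, z.1 < a m & ht m <= z.2]) c ->
  size c <= a m - r m.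

Lemma vert_low y x : y < d -> vert y x = (x < d).
Proof. by case: y => //= y ->. Qed.

Lemma vertS y x : d <= y.+1 ->
  vert y.+1 x = [&& occ y x, ~~ horiz y x & ~~ sink y x].
Proof. by move=> h /=; rewrite ltnNge h. Qed.

#[local] Arguments vert : simpl never.

Lemma horizE y x :
  horiz y x = [&& x.+1 < d, ~~ vert y x.+1 & mark y x.+1 || horiz y x.+1].
Proof. exact: horE. Qed.

Lemma vert_lt y x : vert y x -> x < d.
Proof.
elim: y x => [|y IH] x //; case: (ltnP y.+1 d) => h; first by rewrite vert_low.
rewrite vertS // => /and3P[/orP[/IH//|/andP[x0 hx]] _ _].
by move: hx; rewrite horE => /and3P[]; case: x x0.
Qed.

Lemma right_of_down y x : right_of y.+1 x -> right_of y x.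
Proof. by case=> m [h1 h2]; exists m; split=> //; lia. Qed.

Lemma right_of_next y x : right_of y x -> right_of y x.+1.
Proof. by case=> m [h1 h2]; exists m; split=> //; lia. Qed.

Lemma sink_right y x : sink y x -> right_of y x.+1.
Proof. by move=> /(sinkP _ _ a0 aS) [m [_ h1 h2]]; exists m.+1; rewrite h1 h2. Qed.

Lemma right_of_sink y x : right_of y.+1 x -> ~~ sink y x.
Proof.
case=> m [h1 h2]; apply/negP => /(sinkP _ _ a0 aS) [k [_ h3 h4]].
have km : k < m.
  by rewrite ltnNge; apply/negP => /leqW /(ht_mono d a0 aS); lia.
by have := a_mono a0 aS km; lia.
Qed.

(** Induction on rows: in this region no path ends, and none steps aside because the next column
    already has a path arriving from below. So every column stays occupied. *)
Lemma vert_right y x : right_of y x -> x < d -> vert y x.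
Proof.
elim: y x => [|y IH] x hr xd //; case: (ltnP y.+1 d) => h.
  by rewrite vert_low.
have hr' := right_of_down hr.
rewrite vertS // /occ /occupied IH // right_of_sink // andbT /=.
by rewrite horizE; case: (ltnP x.+1 d) => // xd'; rewrite IH //; exact: right_of_next.
Qed.

Lemma horiz_right y x : right_of y x.+1 -> ~~ horiz y x.
Proof.
by move=> hr; rewrite horizE; case: (ltnP x.+1 d) => // h; rewrite vert_right.
Qed.

Lemma sink_horiz y x : sink y x -> ~~ horiz y x.
Proof. by move/sink_right/horiz_right. Qed.

(* The leftmost marked point of row y has a path weakly to its left. *)
Definition sourced y : Prop := mark y 0 || horiz y 0 -> vert y 0.

Lemma row_flow y x : sourced y -> d <= y.+1 -> x <= d ->
  count (vert y) (iota 0 x) =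
  count (vert y.+1) (iota 0 x) + count (sink y) (iota 0 x)
  + ((0 < x) && horiz y x.-1).
Proof.
move=> hs hy xd; rewrite (@flow d _ (mark y) (sink y)) //.
- by rewrite (eq_count (fun z => vertS z hy)).
- by move=> z; rewrite /mark orbC => ->.
- exact: sink_horiz.
Qed.

(** The corners move weakly right and up with m, so the only possible end point here is that of
    value m + 1, and only if the boundary goes up after corner m. *)
Lemma sink_count y x m : a m = x -> ht m = y -> x <= d ->
  count (sink y) (iota 0 x) = ((r m < r m.+1) && (a m.+1 == a m)).
Proof.
move=> am hm xd; have am' := a_ht d a0 aS m; have am1 := a_ht d a0 aS m.+1.
have as1 := aS m.
have key z : z < x -> sink y z = [&& r m < r m.+1, a m.+1 == a m & z.+1 == x].
  move=> zx; apply/(sinkP _ _ a0 aS)/and3P => [[k [h1 h2 h3]]|[h1 /eqP h2 /eqP h3]].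
    have mk : m <= k.
      by rewrite leqNgt; apply/negP => /(ht_mono d a0 aS); lia.
    have := a_mono a0 aS (leqW mk); have := a_mono a0 aS mk; have := ht_mono d a0 aS mk.
    have ak := a_ht d a0 aS k; have ak1 := a_ht d a0 aS k.+1.
    move=> ? ? ?; have -> : m = k by lia.
    by split=> //; apply/eqP; lia.
  by exists m; split=> //; lia.
case: x am xd key => [|x] am xd key.
  have := ra m.+1; have := ra m => h1 h2 /=; case: eqP => //= e.
    by rewrite andbT; case: ltnP => //; lia.
  by rewrite andbF.
rewrite iota0Sr count_cat /= addn0 key // eqxx andbT (eq_in_count (a2 := pred0)).
  by rewrite count_pred0.
move=> z; rewrite mem_iota => /andP[_]; rewrite add0n => zx.
by rewrite key; [rewrite eqSS (ltn_eqF zx) !andbF|lia].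
Qed.

(** Induction along the boundary path. A vertical step crosses a row that no path leaves to the
    right and in which one path ends iff [r] jumps. A horizontal step adds a column, which carries a
    path unless that path has just ended below. *)
Lemma corner_count m : (forall y, y < ht m -> sourced y) ->
  count (vert (ht m)) (iota 0 (a m)) + r m = a m.
Proof.
elim: m => [|m IH] hs; first by rewrite a0 r0.
have am' := a_ht d a0 aS m; have am1 := a_ht d a0 aS m.+1.
have as1 := aS m; have rs1 := rS m; have ad1 := a_le_d m.+1.
have hm := ht_mono d a0 aS (leqnSn m); have ad := a_le_d m.
have {}IH := IH (fun y h => hs y (leq_trans h hm)).
have := a_le a0 aS m => aml.
case: (leqP (a m.+1) (a m)) => hj.
  have ea : a m.+1 = a m by lia.
  have eh : ht m.+1 = (ht m).+1 by lia.
  have := row_flow (hs (ht m) _) _ ad; rewrite eh ea => fl.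
  have := sink_count (erefl (a m)) (erefl (ht m)) ad; rewrite ea eqxx andbT => sk.
  move: fl; rewrite ltnS leqnn sk => /(_ isT).
  have -> : (0 < a m) && horiz (ht m) (a m).-1 = false.
    case: (posnP (a m)) => //= a_gt; apply/negbTE/horiz_right.
    by exists m.+1; rewrite eh ea; split; lia.
  by case: ltnP => ? /(_ _) fl; have := fl ltac:(lia); lia.
have ea : a m.+1 = (a m).+1 by lia.
have eh : ht m.+1 = ht m by lia.
rewrite ea eh iota0Sr count_cat /= addn0.
have [y ey] : exists y, ht m = y.+1 by exists (ht m).-1; lia.
have ro : right_of y (a m) by exists m; split=> //; lia.
have -> : vert (ht m) (a m) = ~~ (r m < r m.+1).
  rewrite ey vertS; last lia.
  rewrite /occ /occupied vert_right //; last lia.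
  rewrite horiz_right /=; last exact: right_of_next.
  congr (~~ _); apply/(sinkP _ _ a0 aS)/idP => [[k [h1 h2 h3]]|h].
    have -> // : m = k by have := a_ht d a0 aS k.+1; lia.
  by exists m; split=> //; lia.
by case: ltnP => ?; lia.
Qed.

(** The rectangle is that of the first corner to the right of x. Were (x, y) below it, the corner
    before would put (x, y) in the region where every column is occupied. *)
Lemma not_right y x : x < d -> ~~ vert y x -> exists m, x < a m /\ ht m <= y.
Proof.
move=> xd nv; have [n an] := aD.
have ex : exists m, x < a m by exists n; rewrite an.
case: (ex_minnP ex) => -[|k] hk kmin; first by move: hk; rewrite a0.
exists k.+1; split=> //; rewrite leqNgt; apply: contra nv => hy.
apply: vert_right => //; exists k.
have ak : a k <= x by rewrite leqNgt; apply/negP => /kmin; lia.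
by have := aS k; have := a_ht d a0 aS k; have := a_ht d a0 aS k.+1; split; lia.
Qed.

Lemma count_vert_gap y x z : x <= z ->
  (forall x', x <= x' < z -> ~~ vert y x') ->
  count (vert y) (iota 0 z) = count (vert y) (iota 0 x).
Proof.
move=> xz h; rewrite -(subnKC xz) iotaD count_cat add0n.
rewrite [X in _ + X](eq_in_count (a2 := pred0)) ?count_pred0 ?addn0 // => x'.
by rewrite mem_iota subnKC // => /h /negbTE.
Qed.

(** The boundary rises to the corner in question, since otherwise column x would be occupied from
    below. The excess 1 over [corner_count] is the sink itself, which [r m] already counts. *)
Lemma sink_vert_count y x : (forall y', y' < y -> sourced y') -> sink y x ->
  ~~ vert y x -> exists m, [/\ a m = x.+1, ht m = y.+1 &
    count (vert y) (iota 0 x.+1) + r m = (a m).+1].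
Proof.
move=> hs /(sinkP _ _ a0 aS) [k [h1 h2 h3]] nv; exists k.+1; split=> //.
have am' := a_ht d a0 aS k; have am1 := a_ht d a0 aS k.+1; have as1 := aS k.
have ak : a k = x.+1.
  apply/eqP; apply: contraNT nv => ne; apply: vert_right; last first.
    by have := a_le_d k.+1; lia.
  by exists k; split; lia.
have hk : ht k = y by lia.
have := @corner_count k; rewrite hk ak => /(_ hs); have := rS k; lia.
Qed.

(* If few paths leave row y - 1 to the left of x, they were moved to the right
   by a chain of points of g. *)
Lemma vert_count_ge y x : (forall y', y' < y -> sourced y') -> d <= y ->
  (exists m, x <= a m /\ ht m <= y) ->
  exists m c, [/\ sorted chain_rel c,
    all (fun z => [&& g z.2 z.1, z.1 < a m & ht m <= z.2]) c,
    all (fun z => (x <= z.1) && (z.2 < y)) c,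
    x <= a m /\ ht m <= y & a m <= r m + size c + count (vert y) (iota 0 x)].
Proof.
elim: y x => [|y IH] x hs dy [m0 [hx hm]]; first by exfalso; lia.
have [k [km ak]] := a_reach a0 aS hx.
have {m0 hx hm km} hk : ht k <= y.+1 by have := ht_mono d a0 aS km; lia.
have hsS y' : y' < y -> sourced y' by move=> ?; apply: hs; lia.
(* At a corner the count is exact and the empty chain does. *)
have [[k' [ak' hk']]|nk] := pselect (exists k', a k' = x /\ ht k' = y.+1).
  exists k', [::]; split=> //=; first by split; lia.
  by have := @corner_count k'; rewrite hk' ak' => /(_ hs); lia.
have {}hk : ht k <= y.
  by case: (ltngtP (ht k) y.+1) hk => // e _; case: nk; exists k.
have dhk : d <= ht k by have := a_le a0 aS k; have := a_ht d a0 aS k; lia.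
have dy' : d <= y by lia.
have xd : x <= d by rewrite -ak.
have ns : count (sink y) (iota 0 x) = 0.
  rewrite (eq_in_count (a2 := pred0)) ?count_pred0 // => z.
  rewrite mem_iota add0n => /andP[_ zx]; apply/(sinkP _ _ a0 aS) => -[j [h1 h2 h3]].
  have kj : k <= j.+1 by rewrite leqNgt; apply/negP => /ltnW/(ht_mono d a0 aS); lia.
  by have := a_mono a0 aS kj => ?; apply: nk; exists j.+1; lia.
(* From row y to row y + 1 the count drops, by 1, iff a path steps from x - 1 to x in row y. *)
have := row_flow (hs y _) dy xd; rewrite ltnSn ns addn0 => /(_ isT) fl.
case: (boolP ((0 < x) && horiz y x.-1)) fl => [/andP[x0 hh]|_] fl; last first.
  case: (IH x hsS dy') => [|m [c [h1 h2 h3 [h4 h5] h6]]].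
    by exists k; rewrite ak.
  exists m, c; split=> //; [|by split; lia|lia].
  by apply: sub_all h3 => z /andP[-> /= ?]; lia.
have [z [/andP[z1 z2] pz ez]] := hor_witness hh.
have gap : count (vert y) (iota 0 z.+1) = count (vert y) (iota 0 x).
  by apply: count_vert_gap; [lia | move=> x' ?; apply: ez; lia].
have nz : ~~ vert y z by apply: ez; lia.
case/orP: pz => pz; last first.
  have [m [h1 h2 h3]] := sink_vert_count hsS pz nz.
  by exists m, [::]; split=> //=; lia.
(* The point (z, y) of [g] that caused the step pays for the lost path; the chain continues below it
   and to its right. *)
case: (IH z.+1 hsS dy') => [|m [c [h1 h2 h3 [h4 h5] h6]]].
  by have [m [? ?]] := not_right z2 nz; exists m.
exists m, ((z, y) :: c); split=> /=.
- by rewrite path_min_sorted.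
- by rewrite h2 pz h5 h4.
- by rewrite ltnSn andbT; apply/andP; split; [lia|apply: sub_all h3 => t; lia].
- by split; lia.
- by move: h6; rewrite gap; lia.
Qed.

(** In the first blocked row no path arrives weakly left of some marked z. If z is a sink, the count
    at its corner would force r m > a m. If it is a point of [g], all paths in a rectangle were lost
    to a chain, and putting (z, y) in front makes the chain too long. *)
Lemma sourced_all y : sourced y.
Proof.
elim/ltn_ind: y => y hs; case: (ltnP y d) => [yd _|dy hp].
  by rewrite vert_low.
apply/negPn/negP => nv0.
have [z [zd pz ez]] : exists z, [/\ z < d, mark y z &
    forall x', x' <= z -> ~~ vert y x'].
  case/orP: hp => [p0|h0]; first by exists 0; split=> // -[].
  have [z [zd pz ez]] := hor_witness h0; exists z; split=> //; first lia.
  by case=> // x' ?; apply: ez; lia.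
have gap : count (vert y) (iota 0 z.+1) = 0.
  by rewrite (count_vert_gap (leq0n z.+1)) // => x' ?; apply: ez; lia.
have nz := ez z (leqnn z); case/orP: pz => pz; last first.
  have [m [h1 h2]] := sink_vert_count hs pz nz; rewrite gap => h3.
  by have := ra m; lia.
have [|m [c [h1 h2 h3 [h4 h5] h6]]] := vert_count_ge (x := z.+1) hs dy.
  by have [m [? ?]] := not_right zd nz; exists m.
have hc : sorted chain_rel ((z, y) :: c).
  by rewrite /= path_min_sorted.
have := g_chain (m := m) hc; rewrite /= h2 pz h5 h4 => /(_ isT).
by move: h6; rewrite gap; lia.
Qed.

Lemma vert_top y n x : a n = d -> r n = d -> ht n = y -> ~~ vert y x.
Proof.
move=> an rn hn; apply/negP => h; have xd := vert_lt h.
have := @corner_count n (fun y _ => @sourced_all y); rewrite an rn hn => e.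
have : has (vert y) (iota 0 d) by apply/hasP; exists x => //; rewrite mem_iota.
by rewrite has_count; lia.
Qed.

Lemma occ_hor y x : x < d -> mark y x || horiz y x -> occ y x.
Proof. exact/occupied_hor/sourced_all. Qed.

End Construction.

Arguments vert : simpl never.

(** * Nonintersecting families *)

Definition nat_step (p : nat * nat) (up : bool) : nat * nat :=
  if up then (p.1, p.2.+1) else (p.1.+1, p.2).

Definition walk_pt (p : nat * nat) (s : seq bool) (k : nat) : nat * nat :=
  foldl nat_step p (take k s).

Lemma walk_pt0 p s : walk_pt p s 0 = p.
Proof. by rewrite /walk_pt take0. Qed.

Lemma walk_ptS p s k : k < size s ->
  walk_pt p s k.+1 = nat_step (walk_pt p s k) (nth false s k).
Proof. by move=> ks; rewrite /walk_pt (take_nth false) // foldl_rcons. Qed.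

Lemma walk_pt_sum p s k : k <= size s ->
  (walk_pt p s k).1 + (walk_pt p s k).2 = p.1 + p.2 + k.
Proof.
elim: k => [|k IH] ks; first by rewrite walk_pt0 addn0.
rewrite walk_ptS //; have := IH (ltnW ks).
by case: (walk_pt p s k) => x y /=; case: nth => /=; lia.
Qed.

Lemma walk_pt_mono p s i j : i <= j <= size s ->
  (walk_pt p s i).1 <= (walk_pt p s j).1 /\ (walk_pt p s i).2 <= (walk_pt p s j).2.
Proof.
case/andP=> ij; rewrite -(subnKC ij); elim: (j - i) => [|k IH] h.
  by rewrite addn0.
move: h IH; rewrite addnS => h /(_ (ltnW h)); rewrite walk_ptS //.
by case: (walk_pt p s (i + k)) => x y /=; case: nth => /=; lia.
Qed.

Lemma walk_not_chain p s i j : i <= size s -> j <= size s ->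
  ~~ chain_rel (walk_pt p s i) (walk_pt p s j).
Proof.
move=> hi hj; rewrite /chain_rel; have [ij|ji] := leqP i j.
  by have := @walk_pt_mono p s i j; rewrite ij => /(_ hj) [_]; lia.
by have := @walk_pt_mono p s j i; rewrite (ltnW ji) => /(_ hi) []; lia.
Qed.

Lemma sorted_chain_total c z z' : sorted chain_rel c -> z \in c -> z' \in c ->
  [\/ z = z', chain_rel z z' | chain_rel z' z].
Proof.
move=> sc zc zc'.
have key u v : u \in c -> v \in c -> index u c < index v c -> chain_rel u v.
  move=> uc vc h; have := sorted_ltn_nth chain_rel_trans (0, 0) sc.
  move=> /(_ (index u c) (index v c)); rewrite !inE !index_mem => /(_ uc vc h).
  by rewrite !nth_index.
case: (ltngtP (index z c) (index z' c)) => h.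
- by apply: Or32; apply: key.
- by apply: Or33; apply: key.
- by apply: Or31; rewrite -(nth_index (0, 0) zc) h nth_index.
Qed.

Section Families.
Variable d : nat.

Definition start (l : 'I_d) : nat * nat := (d.-1 - l, d.-1).

Section OneFamily.
Variables (sink : pred (nat * nat)) (P : 'I_d -> seq bool).

Definition fpt (l : 'I_d) (k : nat) : nat * nat := walk_pt (start l) (P l) k.

Definition edge (z : nat * nat) (b : bool) : Prop :=
  exists l k, [/\ k < size (P l), fpt l k = z & nth false (P l) k = b].

Definition on_family (z : nat * nat) : Prop :=
  exists l k, k <= size (P l) /\ fpt l k = z.

Definition turn (z : nat * nat) : Prop :=
  exists l k, [/\ k.+1 < size (P l), ~~ nth false (P l) k,
                  nth false (P l) k.+1 & fpt l k.+1 = z].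

(** The permutation of the end points is left implicit; it is recovered from disjointness in
    [mem_path_families]. *)
Definition is_family : Prop :=
  [/\ forall l l' i j, i <= size (P l) -> j <= size (P l') ->
        fpt l i = fpt l' j -> l = l',
      forall l, sink (fpt l (size (P l)))
    & forall z, sink z -> exists l, fpt l (size (P l)) = z].

Hypothesis sink_lt : forall z, sink z -> z.1 < d.
Hypothesis famP : is_family.

Lemma fpt_inj l l' i j : i <= size (P l) -> j <= size (P l') ->
  fpt l i = fpt l' j -> l = l' /\ i = j.
Proof.
move=> hi hj e; have [fam _ _] := famP; have el := fam _ _ _ _ hi hj e.
subst l'; split=> //; have := walk_pt_sum (start l) hi.
by have := walk_pt_sum (start l) hj; rewrite -/(fpt l i) -/(fpt l j) e; lia.
Qed.

Lemma fpt_lt l k : k <= size (P l) -> (fpt l k).1 < d.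
Proof.
move=> h; have [_ fam _] := famP; have := sink_lt (fam l).
have := @walk_pt_mono (start l) (P l) k (size (P l)).
by rewrite h leqnn -/(fpt _ _) -/(fpt _ _) => /(_ isT) [? _]; lia.
Qed.

(** The starting points fill the columns of row d - 1, so a horizontal first step would lead to the
    start of another path or out of the grid. *)
Lemma first_up l : 0 < size (P l) -> nth false (P l) 0.
Proof.
move=> h; apply/negPn/negP => /negbTE e.
have := walk_ptS (start l) h; rewrite e walk_pt0 -/(fpt l 1) /= => e1.
have := fpt_lt h; rewrite e1 /= => lt1.
have l0 : 0 < l by have := ltn_ord l; lia.
have l1d : l.-1 < d by have := ltn_ord l; lia.
have : fpt (Ordinal l1d) 0 = fpt l 1.
  rewrite e1 /fpt walk_pt0 /start /=; congr (_, _).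
  by have := ltn_ord l; lia.
by case/fpt_inj.
Qed.

Lemma fpt_ge l k : 0 < k <= size (P l) -> d <= (fpt l k).2.
Proof.
move=> /andP[k0 ks]; have s0 : 0 < size (P l) by lia.
have := @walk_pt_mono (start l) (P l) 1 k; rewrite k0 ks => /(_ isT) [_].
rewrite (walk_ptS _ s0) first_up // walk_pt0 -/(fpt l k) /=; lia.
Qed.

Lemma edge_fun z b b' : edge z b -> edge z b' -> b = b'.
Proof.
move=> [l [k [h1 h2 <-]]] [l' [k' [h1' h2' <-]]].
have [] := @fpt_inj l l' k k' (ltnW h1) (ltnW h1'); first by rewrite h2.
by move=> -> ->.
Qed.

Lemma edge_pred z b z' b' : edge z b -> edge z' b' ->
  nat_step z b = nat_step z' b' -> b = b'.
Proof.
move=> [l [k [h1 <- <-]]] [l' [k' [h1' <- <-]]].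
rewrite /fpt -!walk_ptS // -/(fpt l k.+1) -/(fpt l' k'.+1).
by case/fpt_inj=> // -> [->].
Qed.

Lemma edge_on z b : edge z b -> on_family (nat_step z b).
Proof. by move=> [l [k [h1 <- <-]]]; exists l, k.+1; rewrite /fpt walk_ptS. Qed.

Lemma on_family_pred z : d <= z.2 -> on_family z ->
  exists z' b, edge z' b /\ nat_step z' b = z.
Proof.
move=> dz [l [[|k] [h e]]]; subst z; first by move: dz; have := ltn_ord l; rewrite /fpt walk_pt0 /=; lia.
by exists (fpt l k), (nth false (P l) k); split; [exists l, k|rewrite -walk_ptS].
Qed.

Lemma on_family_succ z : on_family z -> sink z \/ exists b, edge z b.
Proof.
move=> [l [k [h <-]]]; have [_ fam _] := famP.
move: h; rewrite leq_eqVlt => /orP[/eqP ->|h]; [by left|right].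
by exists (nth false (P l) k), l, k.
Qed.

Lemma sink_edge z b : sink z -> ~ edge z b.
Proof.
have [_ _ fam] := famP; move=> /fam [l' e] [l [k [h1 h2 _]]].
have [] := @fpt_inj l l' k (size (P l')) (ltnW h1) (leqnn _).
  by rewrite h2.
by move=> ? ?; subst; move: h1; rewrite ltnn.
Qed.

Lemma sink_on z : sink z -> on_family z.
Proof. by have [_ _ fam] := famP; move=> /fam [l <-]; exists l, (size (P l)). Qed.

Lemma edge_hor_row z : edge z false -> d <= z.2.
Proof.
move=> [l [[|k] [h <- e]]]; last by apply: fpt_ge; apply: ltnW.
by have := first_up h; rewrite e.
Qed.

Lemma edge_hor_lt z : edge z false -> z.1.+1 < d.
Proof.
by move=> /edge_on [l [k [h e]]]; have := fpt_lt h; rewrite e.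
Qed.

Lemma hor_next z : edge z false ->
  [\/ edge (z.1.+1, z.2) false, turn (z.1.+1, z.2) | sink (z.1.+1, z.2)].
Proof.
move=> [l [k [h1 h2 h3]]]; have [_ fam _] := famP.
have e : fpt l k.+1 = (z.1.+1, z.2) by rewrite /fpt walk_ptS // h3 -/(fpt _ _) h2.
move: (h1); rewrite leq_eqVlt => /orP[/eqP h|h].
  by apply: Or33; rewrite -e h.
case h4 : (nth false (P l) k.+1); last by apply: Or31; exists l, k.+1.
by apply: Or32; exists l, k; rewrite h3 h4.
Qed.

End OneFamily.

(** * Uniqueness of the family for a given set of points *)

Section Uniqueness.
Variables (sink G : pred (nat * nat)).
Hypothesis sink_lt : forall z, sink z -> z.1 < d.

(** G lies in the interval [R(P), F(P)], up to starting points, which are not reflections. *)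
Definition compatible (P : 'I_d -> seq bool) : Prop :=
  [/\ is_family sink P, forall z, turn P z -> G z
    & forall z, G z -> on_family P z].

(* The run of P to the right of (x, y) stops at a turn or a sink, which Q also
   visits; as no edge from below leads Q into that run, Q comes from (x, y). *)
Lemma hor_edge_sub P Q x y : compatible P -> compatible Q ->
  (forall x y', y'.+1 = y -> edge Q (x, y') true -> edge P (x, y') true) ->
  edge P (x, y) false -> edge Q (x, y) false.
Proof.
move=> [fP tP _] [fQ _ cQ] up.
move: {2}(d - x) (leqnn (d - x)) => k; elim: k x => [|k IH] x hk e.
  by have := edge_hor_lt sink_lt fP e; rewrite /=; lia.
have hy := edge_hor_row sink_lt fP e; have hx := edge_hor_lt sink_lt fP e.
have onQ : on_family Q (x.+1, y).
  case: (hor_next fP e) => [e1|/tP/cQ //|/(sink_on fQ) //].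
  have [|l [j [h1 h2 _]]] := IH x.+1 _ e1; first by move: hx => /=; lia.
  by exists l, j; rewrite ltnW.
have [] := on_family_pred _ onQ => [|]; first by [].

case=> [x' y'] [[] [eQ /= [ex ey]]]; last by rewrite ex ey in eQ.
by have := edge_pred fP (up _ _ ey eQ) e; rewrite /= ex ey => /(_ erefl).
Qed.

(** The edge by which P enters (x, y) is shared with Q, so Q visits (x, y), as it also does if this
    is a start. Q does not end there, as P goes on and the sinks are the same, nor leave
    horizontally, as P would too. *)
Lemma up_edge_sub P Q x y : compatible P -> compatible Q ->
  (forall x y', y'.+1 = y -> edge P (x, y') true -> edge Q (x, y') true) ->
  (forall x, edge P (x, y) false <-> edge Q (x, y) false) ->
  edge P (x, y) true -> edge Q (x, y) true.
Proof.
move=> [fP tP _] [fQ _ cQ] up hor e.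
have onQ : on_family Q (x, y).
  have := e; case=> l [[|k] [h1 h2 h3]].
    by exists l, 0; split=> //; rewrite -h2 /fpt !walk_pt0.
  have := h2; rewrite /fpt walk_ptS; last exact: ltnW.
  have : edge P (fpt P l k) (nth false (P l) k) by exists l, k; rewrite ltnW.
  rewrite -/(fpt P l k); case: (fpt P l k) => x' y'.
  case: nth => e' [ex ey]; subst.
    by apply: (edge_on (z := (x, y')) (b := true)); exact: up.
  by apply: (edge_on (z := (x', y)) (b := false)); apply/hor.
case: (on_family_succ fQ onQ) => [/(sink_edge fP)/(_ e)//|[[//|/hor e']]].
by have := edge_fun fP e e'.
Qed.

Lemma edge_eq P Q z b : compatible P -> compatible Q -> edge P z b -> edge Q z b.
Proof.
move=> cP cQ; case: z => x y.
suff : forall y, (forall x, edge P (x, y) true <-> edge Q (x, y) true)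
   /\ (forall x, edge P (x, y) false <-> edge Q (x, y) false).
  by move=> /(_ y) [h1 h2]; case: b => [/h1|/h2].
(* The vertical edges into a row determine its horizontal edges, and these determine the vertical
   edges out of it. *)
move=> {x b} {}y; elim: y => [|y [IH _]].
  have hor x : edge P (x, 0) false <-> edge Q (x, 0) false.
    by split; apply: hor_edge_sub.
  by split=> // x; split; apply: up_edge_sub => // z; split=> /hor.
have hor x : edge P (x, y.+1) false <-> edge Q (x, y.+1) false.
  by split; apply: hor_edge_sub => // z _ [->] /IH.
split=> // x; split; apply: up_edge_sub => // z; try by split=> /hor.
  by move=> _ [->] /IH.
by move=> _ [->] /IH.
Qed.

Lemma compatible_unique P Q : compatible P -> compatible Q -> P =1 Q.
Proof.
move=> cP cQ.
have key R S l k : compatible R -> compatible S -> k <= size (R l) ->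
    take k (R l) = take k (S l) /\ k <= size (S l).
  move=> cR cS; elim: k => [|k IH] h; first by rewrite !take0.
  have [e h'] := IH (ltnW h); have [fS _ _] := cS.
  have : edge S (fpt R l k) (nth false (R l) k).
    by apply: (edge_eq cR cS); exists l, k.
  case=> l' [k' [h1 h2 h3]].
  have [] := fpt_inj fS (ltnW h1) h'; first by rewrite h2 /fpt /walk_pt e.
  by move=> ? ?; subst; split=> //; rewrite !(take_nth false) // e h3.
move=> l; have [e1 h1] := key _ _ l _ cP cQ (leqnn _).
have [e2 h2] := key _ _ l _ cQ cP (leqnn _).
by move: e1; rewrite take_size take_oversize.
Qed.
End Uniqueness.
End Families.

Section FamilyExistence.
Variables (d : nat) (a r : nat -> nat).

Local Notation ht := (ht d a).
Local Notation snk := (fun z : nat * nat => sink d a r z.2 z.1).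

Hypothesis d_gt0 : 0 < d.
Hypothesis a0 : a 0 = 0.
Hypothesis aS : forall m, a m <= a m.+1 <= (a m).+1.
Hypothesis a_le_d : forall m, a m <= d.
Hypothesis r0 : r 0 = 0.
Hypothesis rS : forall m, r m <= r m.+1 <= (r m).+1.
Hypothesis ra : forall m, r m <= a m.

Lemma sink_lt z : snk z -> z.1 < d.
Proof. by move=> /(sinkP _ _ a0 aS) [m [_ e _]]; rewrite -e. Qed.

(** * The bound on chains of points of a family *)

Section Soundness.
Variable P : 'I_d -> seq bool.
Hypothesis famP : is_family snk P.

Definition path_of (z : nat * nat) : 'I_d :=
  odflt (Ordinal d_gt0)
    [pick l | `[< exists k, k <= size (P l) /\ fpt P l k = z >]].

Lemma path_ofP z : on_family P z ->
  exists k, k <= size (P (path_of z)) /\ fpt P (path_of z) k = z.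
Proof.
move=> [l h]; rewrite /path_of; case: pickP => [l' /asboolP //|/(_ l)].
by move/asboolP.
Qed.

(* All a m paths that start in a column left of a m are counted, r m of which end
   outside of the rectangle; each of the others meets the chain once at most. *)
Lemma family_chain m c : sorted chain_rel c ->
  (forall z : nat * nat, z \in c -> [/\ on_family P z, z.1 < a m & ht m <= z.2]) ->
  size c <= a m - r m.
Proof.
move=> sc hc; have [_ fam2 fam3] := famP.
(* [K] encodes the r m sinks of value at most m; [s] lists the paths through the chain and those
   ending in these sinks. *)
pose K := [seq k <- iota 0 m | r k < r k.+1].
pose s := [seq path_of z | z <- c] ++ [seq path_of (sink_pt d a k) | k <- K].
have hK (k : nat) : k \in K -> k < m /\ r k < r k.+1.
  by rewrite mem_filter mem_iota => /andP[-> /andP[_ ?]].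
have sz : size K = r m.
  rewrite size_filter; elim: (m) => [|j IH]; first by rewrite r0.
  by rewrite iota0Sr count_cat IH /= addn0; have := rS j; case: ltnP; lia.
have uc : uniq c by apply: (sorted_uniq chain_rel_trans) sc => x; rewrite /chain_rel ltnn.
have end_of (k : nat) : k \in K ->
    fpt P (path_of (sink_pt d a k)) (size (P (path_of (sink_pt d a k)))) = sink_pt d a k.
  move=> /hK [_ hk]; have hs := sink_sink_pt a0 aS ra d_gt0 hk; have [l el] := fam3 _ hs.
  have [j [h1 h2]] := path_ofP (sink_on famP hs).
  have [] := fpt_inj famP h1 (leqnn (size (P l))); first by rewrite h2 el.
  by move=> ? ?; subst l.
have us : uniq s.
  rewrite cat_uniq; apply/and3P; split.
  (* A path increases weakly in both coordinates and so meets a chain at most once. *)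
  - rewrite map_inj_in_uniq // => z z' zc zc' e.
    have [k [h1 h2]] := path_ofP (let: And3 h _ _ := hc z zc in h).
    have [k' [h1' h2']] := path_ofP (let: And3 h _ _ := hc z' zc' in h).
    case: (sorted_chain_total sc zc zc') => //; rewrite -h2 -h2' -e.
      by rewrite (negbTE (walk_not_chain _ h1 _)) // e.
    by rewrite (negbTE (walk_not_chain _ _ h1)) // e.
  (* A path that has met the m-th rectangle stays above all the sinks of [K]. *)
  - apply/hasPn => _ /mapP[k kK ->]; apply/negP => /mapP[z zc e].
    have [h1 h2 h3] := hc z zc; have [j [h4 h5]] := path_ofP h1.
    have := @walk_pt_mono (start (path_of z)) (P (path_of z)) j (size (P (path_of z))).
    rewrite h4 leqnn => /(_ isT) [_]; rewrite -/(fpt _ _ _) -/(fpt _ _ _) h5 -e end_of //=.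
    have [km _] := hK k kK; move/leq_ltn_trans => /(_ (ht m)).
    by rewrite prednK ?(leq_trans d_gt0 (ht_ge d a0 aS _)) // ltnNge h3 (ht_mono d a0 aS km) => /(_ isT).
  - rewrite map_inj_in_uniq ?filter_uniq ?iota_uniq // => k k' kK kK' e.
    have := end_of k kK; rewrite e end_of // => -[e1 e2].
    have [_ h] := hK k kK; have [_ h'] := hK k' kK'.
    have := a_ht d a0 aS k.+1; have := a_ht d a0 aS k'.+1.
    have := ra k.+1; have := ra k'.+1.
    by have := a_le a0 aS k.+1; have := a_le a0 aS k'.+1; lia.
(* Paths never move left, so they start left of column a m, and starting columns are distinct. *)
have start_lt l : l \in s -> d.-1 - l < a m.
  rewrite mem_cat => /orP[/mapP[z zc ->]|/mapP[k kK ->]].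
    have [h1 h2 h3] := hc z zc; have [j [h4 h5]] := path_ofP h1.
    have := @walk_pt_mono (start (path_of z)) (P (path_of z)) 0 j.
    by rewrite h4 => /(_ isT) [+ _]; rewrite -/(fpt _ _ j) h5 walk_pt0 /=; lia.
  have := @walk_pt_mono (start (path_of (sink_pt d a k))) (P (path_of (sink_pt d a k))) 0
     (size (P (path_of (sink_pt d a k)))).
  rewrite leqnn => /(_ isT) [+ _]; rewrite -/(fpt _ _ (size _)) end_of // walk_pt0 /=.
  by have [km h] := hK k kK; have := a_mono a0 aS km; have := ra k.+1; lia.
have : size [seq d.-1 - l | l : 'I_d <- s] <= size (iota 0 (a m)).
  apply: uniq_leq_size.
    rewrite map_inj_in_uniq // => l l' _ _ e; apply: val_inj => /=.
    by have := ltn_ord l; have := ltn_ord l'; lia.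
  by move=> _ /mapP[l ls ->]; rewrite mem_iota add0n start_lt.
by rewrite size_map size_iota size_cat !size_map sz; lia.
Qed.
End Soundness.

(** * From the row process to a family of paths *)

Section Existence.
Variables (n : nat) (G : pred (nat * nat)).
Hypothesis an : a n = d.
Hypothesis rn : r n = d.
Hypothesis G_grid : forall z, G z -> z.1 < d <= z.2.
Hypothesis G_chain : forall m c, sorted chain_rel c ->
  all (fun z => [&& G z, z.1 < a m & ht m <= z.2]) c -> size c <= a m - r m.

Let g (y : nat) : pred nat := fun x => G (x, y).

Local Notation vrt := (vert d a r g).
Local Notation hrz := (horiz d a r g).
Local Notation oc := (fun z : nat * nat => occ d a r g z.2 z.1).

Let g_chain m c : sorted chain_rel c ->
  all (fun z => [&& g z.2 z.1, z.1 < a m & ht m <= z.2]) c -> size c <= a m - r m.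
Proof.
by move=> h1 h2; apply: G_chain => //; apply: sub_all h2; case.
Qed.

Let aD : exists k, a k = d. Proof. by exists n. Qed.

Let occ_horiz y x : x < d -> mark d a r g y x || hrz y x -> occ d a r g y x.
Proof. exact: occ_hor. Qed.

Lemma occ_lt y x : occ d a r g y x -> x < d.
Proof.
case/orP => [/(vert_lt d_gt0)//|/andP[]].
by case: x => // x _; rewrite -[hor _ _ _ _]/(hrz y x) horizE => /and3P[].
Qed.

Definition dir (z : nat * nat) : option bool :=
  if hrz z.2 z.1 then Some false else
  if vrt z.2.+1 z.1 then Some true else None.

Fixpoint flow_walk (k : nat) (z : nat * nat) : seq bool :=
  if k is k'.+1 then
    if dir z is Some b then b :: flow_walk k' (nat_step z b) else [::]
  else [::].

Lemma size_flow_walk k z : size (flow_walk k z) <= k.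
Proof. by elim: k z => //= k IH z; case: dir => //= b; exact: IH. Qed.

Lemma dir_flow_walk k z j : j < k -> j <= size (flow_walk k z) ->
  dir (walk_pt z (flow_walk k z) j) =
  if j < size (flow_walk k z) then Some (nth false (flow_walk k z) j) else None.
Proof.
elim: k z j => [|k IH] z [|j] //= jk; case e : (dir z) => [b|] //=.
exact: IH.
Qed.

Lemma dir_occ z b : d.-1 <= z.2 -> dir z = Some b ->
  [/\ oc z, oc (nat_step z b), ~~ snk z & b || ~~ vrt z.2 z.1.+1].
Proof.
rewrite /dir; case: z => x y /= hy; case: ifP => [h [<-]|hh].
  have := h; rewrite horizE => /and3P[xd nv _]; split=> //.
  - by apply: occ_horiz => /=; [lia|rewrite h orbT].
  - by apply/orP; right; exact: h.
  - by apply: contraL h => /sink_horiz; apply.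
case: ifP => // h [<-]; have := h; rewrite vertS; last lia.
by case/and3P=> h1 _ h3; split=> //; apply/orP; left; exact: h.
Qed.

(** A horizontal step is made only into a column where no path arrives from below, so no point is
    entered in two ways. *)
Lemma dir_step_inj z b z' b' : d.-1 <= z.2 -> d.-1 <= z'.2 ->
  dir z = Some b -> dir z' = Some b' -> nat_step z b = nat_step z' b' -> z = z'.
Proof.
move=> hz hz' e e'; have [_ _ _ nb] := dir_occ hz e; have [_ _ _ nb'] := dir_occ hz' e'.
have up t : dir t = Some true -> vrt t.2.+1 t.1.
  by rewrite /dir; case: ifP => // _; case: ifP.
case: z z' {hz hz'} b b' e e' nb nb' => x y [x' y'] [] [] /= e e' nb nb' [] // ex ey; subst=> //.
  by have := up _ e; rewrite /= (negbTE nb').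
by have := up _ e'; rewrite /= (negbTE nb).
Qed.

Definition flow_family (l : 'I_d) : seq bool := flow_walk n (start l).

Local Notation FP := flow_family.

Lemma flow_dir l k : k < n -> k <= size (FP l) -> dir (fpt FP l k) =
  if k < size (FP l) then Some (nth false (FP l) k) else None.
Proof. exact: dir_flow_walk. Qed.

Let dn : d <= n. Proof. by rewrite -an a_le. Qed.

Lemma flow_pt l k : k <= size (FP l) ->
  [/\ oc (fpt FP l k), d.-1 <= (fpt FP l k).2 & (fpt FP l k).2 < n].
Proof.
elim: k => [|k IH] h.
  rewrite /fpt walk_pt0 /start /=; split=> //; last by lia.
  by apply/orP; left; have := ltn_ord l => ?; rewrite vert_low; lia.
have [h1 h2 h3] := IH (ltnW h); have kn : k < n by exact: leq_trans h (size_flow_walk _ _).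
have := flow_dir kn (ltnW h); rewrite h => e.
have [_ h4 _ _] := dir_occ h2 e; split.
- by rewrite /fpt walk_ptS.
- by rewrite /fpt walk_ptS // -/(fpt _ _ _); case: nth => /=; lia.
rewrite /fpt walk_ptS // -/(fpt _ _ _).
case: nth e h4 => //= e _; rewrite ltn_neqAle h3 andbT; apply/eqP => en.
have hn : ht n = n by have := a_ht d a0 aS n; lia.
move: e; rewrite /dir; case: ifP => // _; case: ifP => // + _.
by rewrite en (negbTE (vert_top d_gt0 a0 aS aD a_le_d r0 rS ra g_chain _ an rn hn)).
Qed.

(** After n steps the coordinates would sum to at least n + d - 1, whereas x < d and y < n. *)
Lemma flow_size l : size (FP l) < n.
Proof.
rewrite ltnNge; apply/negP => h; have e : size (FP l) = n.
  by apply/eqP; rewrite eqn_leq h size_flow_walk.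
have [/occ_lt h1 h2 h3] := flow_pt (leqnn (size (FP l))).
have := walk_pt_sum (start l) (leqnn (size (FP l))).
rewrite -/(fpt _ _ _); move: h1 h2 h3; rewrite e /= => h1 h2 h3.
by have := ltn_ord l; lia.
Qed.

(** Paths through a common point are traced back to a common start; by [nostart] no step enters a
    starting point. *)
Lemma flow_pt_inj l l' i j : i <= size (FP l) -> j <= size (FP l') ->
  fpt FP l i = fpt FP l' j -> l = l'.
Proof.
have pre m k : k < size (FP m) -> [/\ d.-1 <= (fpt FP m k).2,
    dir (fpt FP m k) = Some (nth false (FP m) k)
    & fpt FP m k.+1 = nat_step (fpt FP m k) (nth false (FP m) k)].
  move=> h; have [_ h2 _] := flow_pt (ltnW h); split=> //; last by rewrite /fpt walk_ptS.
  by rewrite flow_dir ?(ltn_trans h (flow_size m)) ?(ltnW h) // h.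
have nostart m m' k : k < size (FP m) -> fpt FP m k.+1 <> fpt FP m' 0.
  move=> h; have [h1 h2 ->] := pre _ _ h; rewrite {2}/fpt walk_pt0 /start.
  have [_ _ _] := dir_occ h1 h2; case: (fpt FP m k) h1 => x y /=.
  case: nth => /= hy hv [] ex ey; first by lia.
  by have := ltn_ord m' => ?; move: hv; rewrite ey vert_low; lia.
elim: i j => [|i IH] [|j] hi hj e.
- move: e; rewrite /fpt !walk_pt0 /start => -[e]; apply: val_inj => /=.
  by have := ltn_ord l; have := ltn_ord l'; lia.
- by case: (nostart l' l j).
- by case: (nostart l l' i).
have [h1 h2 h3] := pre _ _ hi; have [h1' h2' h3'] := pre _ _ hj.
apply: (IH j (ltnW hi) (ltnW hj)).
by apply: dir_step_inj h1 h1' h2 h2' _; rewrite -h3 -h3'.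
Qed.

(** An occupied point is entered from below or from the left; going back leads to row d - 1, where
    every column has a start. *)
Lemma flow_on z : oc z -> d.-1 <= z.2 -> on_family FP z.
Proof.
case: z => x y /=; move: {2}(x + y) (leqnn (x + y)) => s.
elim: s x y => [|s IH] x y hs ho hy; have xd := occ_lt ho.
  have l0 : d.-1 < d by lia.
  exists (Ordinal l0), 0; split=> //; rewrite /fpt walk_pt0 /start /=.
  by congr (_, _); lia.
have next z b : on_family FP z -> dir z = Some b -> on_family FP (nat_step z b).
  move=> [l [k [h1 <-]]]; have kn := leq_ltn_trans h1 (flow_size l).
  rewrite flow_dir //; case: ifP => // h2 [<-]; exists l, k.+1; split=> //.
  by rewrite /fpt walk_ptS.
move: (hy); rewrite leq_eqVlt => /orP[/eqP e|hy'].
  have l0 : d.-1 - x < d by lia.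
  exists (Ordinal l0), 0; split=> //; rewrite /fpt walk_pt0 /start /=.
  by congr (_, _); lia.
case: y hs ho hy hy' => // y hs ho hy hy'.
case/orP: (ho) => [v|].
  have := v; rewrite vertS; last lia; case/and3P=> h1 h2 _.
  apply: (@next (x, y) true); first by apply: IH => //; lia.
  by rewrite /dir /= (negbTE h2) v.
case: x hs ho xd => // x hs ho xd; rewrite -[hor _ _ _ _]/(hrz y.+1 x) /= => h.
apply: (@next (x, y.+1) false); last by rewrite /dir /= h.
by apply: IH; [lia|apply: occ_horiz => /=; [lia|rewrite h orbT]|lia].
Qed.

Lemma flow_compatible : compatible snk G FP.
Proof.
have sinkon z : snk z -> on_family FP z.
  move=> hs; apply: flow_on.
    by apply: occ_horiz => /=; [exact: sink_lt|rewrite /mark hs orbT].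
  by move: hs => /(sinkP _ _ a0 aS) [k [_ _ e]]; have := ht_ge d a0 aS k.+1; lia.
split; first split.
- exact: flow_pt_inj.
- move=> l; have [h1 h2 _] := flow_pt (leqnn (size (FP l))).
  have := flow_dir (flow_size l) (leqnn _); rewrite ltnn /dir.
  case: ifP => // nh; case: ifP => // nv _; move: nv; rewrite vertS; last by lia.
  by rewrite h1 nh /= => /negbT; rewrite negbK.
- move=> z hs; have [l [k [h1 h2]]] := sinkon z hs; exists l.
  move: h1; rewrite leq_eqVlt => /orP[/eqP <- //|h1].
  have := flow_dir (ltn_trans h1 (flow_size l)) (ltnW h1); rewrite h1 h2 => e.
  have [_ h3 _] := flow_pt (ltnW h1); rewrite h2 in h3.
  by have [_ _] := dir_occ h3 e; rewrite hs.
(* At a turn the run to the right stops, so the point is marked; as the path goes on it is not a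
   sink, hence it lies in [G]. *)
- move=> z [l [k [h1 h2 h3 <-]]]; have sz := flow_size l.
  have kn : k < n by lia.
  have := flow_dir kn (ltnW (ltnW h1)); rewrite (ltnW h1) (negbTE h2) => e1.
  have kn1 : k.+1 < n by lia.
  have := flow_dir kn1 (ltnW h1); rewrite h1 h3 => e2.
  have [_ hr _] := flow_pt (ltnW h1); have [_ _ ns _] := dir_occ hr e2.
  move: e1 e2 ns; rewrite {2 3 4}/fpt walk_ptS ?(ltnW h1) // (negbTE h2) -/(fpt _ _ _).
  rewrite /dir /=; case: ifP => [|_]; last by case: ifP.
  rewrite horizE => /and3P[_ _ /orP[/orP[+ _ _ _|->]|-> //]] //.
  by rewrite /fpt walk_ptS ?(ltnW h1) // (negbTE h2).
- move=> z hz; apply: flow_on; last by have := G_grid hz; lia.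
  apply: occ_horiz; first by have := G_grid hz; lia.
  by rewrite /mark /g; case: z hz => x y /= ->.
Qed.

End Existence.

End FamilyExistence.

(** * Property (S1) in terms of chains *)

Lemma card_ord_lt n m : m <= n -> #|[set x : 'I_n | x < m]| = m.
Proof.
move=> mn; have inj : injective (widen_ord mn).
  by move=> i j /(congr1 val) /= /val_inj.
rewrite -[RHS](card_ord m) -(card_imset _ inj).
apply/esym/eq_card => x; rewrite inE; apply/imsetP/idP => [[i _ ->] //=|h].
by exists (Ordinal h) => //; apply: val_inj.
Qed.

Lemma mem_downclosed n (A : {set 'I_n}) (x : 'I_n) :
  (forall y z : 'I_n, y < z -> z \in A -> y \in A) -> (x \in A) = (x < #|A|).
Proof.
move=> h; apply/idP/idP => [xA|].
  rewrite -(@card_ord_lt n x.+1 (ltn_ord x)); apply: subset_leq_card.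
  apply/fintype.subsetP => y; rewrite inE ltnS leq_eqVlt => /orP[/eqP/val_inj -> //|yx].
  exact: h yx xA.
apply: contraTT => xA; rewrite -leqNgt -[X in _ <= X](card_ord_lt (ltnW (ltn_ord x))).
apply: subset_leq_card; apply/fintype.subsetP => y yA; rewrite inE ltnNge leq_eqVlt.
apply: contra xA => /orP[/eqP/val_inj -> //|xy]; exact: h xy yA.
Qed.

Lemma sorted_nth_le (s : seq nat) l m : sorted leq s -> l < size s ->
  (nth 0 s l <= m) = (l < count (fun x => x <= m) s).
Proof.
elim: s l => //= x s IH l hs; have ss := path_sorted hs.
have xs := order_path_min leq_trans hs.
case: l => [_|l] /=; last first.
  rewrite ltnS => hl; rewrite IH //; case: (leqP x m) => [_|xm]; first by rewrite add1n ltnS.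
  rewrite (eq_in_count (a2 := pred0)) ?count_pred0 // => y /(allP xs) xy; apply/negbTE; move: xy => /=; lia.
case: (leqP x m) => [_|xm]; first by [].
rewrite (eq_in_count (a2 := pred0)) ?count_pred0 // => y /(allP xs) xy; apply/negbTE; move: xy => /=; lia.
Qed.

(** * Rank functions of cosets *)

Section Counting.
Variables (n d : nat).
Hypothesis dn : d <= n.

(** Values start from 0 here, so [u x < m] means a value at most m in 1..n. For [tau] and [w] this
    gives [a] and [r]. *)
Definition cnt (u : 'S_n) (m : nat) : nat := #|[set x : 'I_n | (x < d) && (u x < m)]|.

Lemma cnt0 u : cnt u 0 = 0.
Proof. by apply: eq_card0 => x; rewrite inE ltn0 andbF. Qed.

Lemma cntS u m : cnt u m <= cnt u m.+1 <= (cnt u m).+1.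
Proof.
apply/andP; split.
  by apply: subset_leq_card; apply/fintype.subsetP => x; rewrite !inE; lia.
have h : #|[set x : 'I_n | u x == m :> nat]| <= 1.
  apply/card_le1P => x; rewrite inE => /eqP ux y; rewrite !inE -ux.
  by rewrite (inj_eq val_inj) (inj_eq perm_inj).
apply: (@leq_trans (cnt u m + #|[set x : 'I_n | u x == m :> nat]|)); last by lia.
apply: leq_trans (leq_card_setU _ _); apply: subset_leq_card.
by apply/fintype.subsetP => x; rewrite !inE; lia.
Qed.

Lemma cnt_max u m : n <= m -> cnt u m = d.
Proof.
move=> nm; rewrite -[RHS](card_ord_lt dn); apply: eq_card => x; rewrite !inE.
by rewrite (leq_trans (ltn_ord _) nm) andbT.
Qed.

Lemma cnt_le u m : cnt u m <= d.
Proof.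
rewrite -[X in _ <= X](card_ord_lt dn); apply: subset_leq_card.
by apply/fintype.subsetP => x; rewrite !inE => /andP[].
Qed.

Lemma cntE u m : cnt u m = count (fun x : 'I_n => (x < d) && (u x < m)) (enum 'I_n).
Proof.
by rewrite /cnt cardsE cardE -size_filter enumT; congr (size _); rewrite /enum_mem.
Qed.

Lemma coset_val_le u l m : l < d -> (coset_val d u l <= m) = (l < cnt u m).
Proof.
move=> ld; rewrite /coset_val; set s := sort _ _.
have ss : sorted leq s by exact: (sort_sorted leq_total).
have sz : size s = d.
  rewrite size_sort size_map size_filter -[RHS](cnt_max u (leqnn n)) cntE.
  by apply: eq_count => x; rewrite ltn_ord andbT.
rewrite sorted_nth_le ?sz // /s.
rewrite (seq.permP (permEl (perm_sort _ _))) count_map count_filter cntE.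
by congr (_ < _); apply: eq_count => x /=; rewrite andbC.
Qed.

Lemma coset_le_cnt u v : coset_le d u v <-> forall m, cnt v m <= cnt u m.
Proof.
split=> [/forallP h m|h]; last first.
  apply/forallP => l; rewrite coset_val_le // (leq_trans _ (h _)) //.
  by rewrite -coset_val_le.
rewrite leqNgt; apply/negP => lt1.
have ld : cnt u m < d := leq_trans lt1 (cnt_le v m).
have := h (Ordinal ld); rewrite leqNgt /= => /negP; apply.
apply: (@leq_ltn_trans m); first by rewrite coset_val_le.
by rewrite ltnNge coset_val_le // ltnn.
Qed.

Section MinRep.
Variable tau : 'S_n.
Hypothesis htau : min_rep d tau.

Lemma min_rep_lt (x y : 'I_n) : x < y -> (y < d) || (d <= x) -> tau x < tau y.
Proof.
by move=> h1 h2; move/forallP/(_ x)/forallP/(_ y)/implyP: htau; apply; rewrite h1.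
Qed.

Lemma tau_lt_low (x : 'I_n) m : x < d -> (tau x < m) = (x < cnt tau m).
Proof.
move=> xd; rewrite /cnt -mem_downclosed ?inE ?xd // => y z yz.
rewrite !inE => /andP[zd zm]; rewrite (ltn_trans yz zd) /=.
by apply: ltn_trans zm; apply: min_rep_lt; rewrite ?zd.
Qed.

(** The first d positions and those of value below m together form an initial segment, whose length
    follows by inclusion-exclusion. *)
Lemma tau_lt_high (y : 'I_n) m : d <= y -> (tau y < m) = (y < ht d (cnt tau) m).
Proof.
move=> dy; case: (leqP m n) => mn; last first.
  rewrite /ht cnt_max ?(ltnW mn) // addKn.
  by rewrite !(ltn_trans (ltn_ord _) mn).
pose A := [set x : 'I_n | (x < d) || (tau x < m)].
have -> : (tau y < m) = (y \in A) by rewrite inE [y < d]ltnNge dy.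
rewrite mem_downclosed; last first.
  move=> x z xz; rewrite !inE; case: (ltnP x d) => //= dx /orP[zd|zm]; first by lia.
  by apply: ltn_trans zm; apply: min_rep_lt; rewrite ?dx ?orbT.
congr (_ < _); rewrite /ht.
have e1 := cardsUI [set x : 'I_n | x < d] [set x : 'I_n | tau x < m].
have e2 : #|[set x : 'I_n | tau x < m]| = m.
  transitivity #|tau @^-1: [set x : 'I_n | x < m]|.
    by apply: eq_card => x; rewrite !inE.
  by rewrite card_preimset ?card_ord_lt //; exact: perm_inj.
have e3 : #|[set x : 'I_n | x < d] :|: [set x : 'I_n | tau x < m]| = #|A|.
  by apply: eq_card => x; rewrite !inE.
have e4 : #|[set x : 'I_n | x < d] :&: [set x : 'I_n | tau x < m]| = cnt tau m.
  by apply: eq_card => x; rewrite !inE.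
by move: e1; rewrite e3 e4 e2 (card_ord_lt dn) => <-; rewrite addnK.
Qed.

End MinRep.
End Counting.

(** * Bruhat order on commuting reflections *)

Section Bruhat.
Variable n : nat.

Lemma bruhat_le_up (u v : 'S_n) (a b : nat) : bruhat_le u v ->
  (exists z : 'I_n, z < a /\ b <= u z) -> exists z : 'I_n, z < a /\ b <= v z.
Proof.
move=> /connectP[p hp ->] {v}; elim: p u hp => //= v p IH u /andP[huv hp] hu.
apply: IH hp _; case/existsP: huv => x /existsP[y /and3P[xy uxy /eqP ->]].
case: hu => z [za zb]; have [ex|nx] := eqVneq z x.
  by exists x; rewrite permM tpermL -ex; split=> //; rewrite ex in zb *; lia.
have [ey|ny] := eqVneq z y.
  by exists x; rewrite permM tpermL -ey; split=> //; rewrite ey in za *; lia.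
by exists z; rewrite permM tpermD 1?eq_sym.
Qed.

Lemma bruhat_stepI (u : 'S_n) (x y : 'I_n) : x < y -> u x < u y ->
  bruhat_le u (tperm x y * u)%g.
Proof.
by move=> h1 h2; apply/connect1/existsP; exists x; apply/existsP; exists y; rewrite h1 h2 /=.
Qed.

Lemma bruhat_nested (x x' y' y : 'I_n) : x < x' -> x' < y' -> y' < y ->
  bruhat_lt (tperm x' y') (tperm x y).
Proof.
move=> h1 h2 h3; have ne (i j : 'I_n) : i < j -> (i == j = false) * (j == i = false).
  by move=> ij; rewrite -!(inj_eq val_inj) /= (ltn_eqF ij) (gtn_eqF ij).
have x_y' := ltn_trans h1 h2; have x'_y := ltn_trans h2 h3; have x_y := ltn_trans x_y' h3.
have E := (ne _ _ h1, ne _ _ h2, ne _ _ h3, ne _ _ x_y', ne _ _ x'_y, ne _ _ x_y).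
apply/andP; split.
  by apply/eqP => /permP/(_ x); rewrite tpermL tpermD ?E // => e; rewrite e ltnn in x_y.
(* At the positions x, x', y', y the values change from x y' x' y via y' x x' y, y' x y x' and y x
   y' x' to y x' y' x; each move exchanges an increasing pair. *)
pose u0 := tperm x' y'; pose u1 := (tperm x x' * u0)%g; pose u2 := (tperm y' y * u1)%g.
pose u3 := (tperm x y' * u2)%g.
have val3 z : [/\ u0 z = tperm x' y' z, u1 z = u0 (tperm x x' z),
    u2 z = u1 (tperm y' y z) & u3 z = u2 (tperm x y' z)] by rewrite !permM.
have -> : tperm x y = (tperm x' y * u3)%g.
  apply/permP => z; rewrite !permM.
  have [->|/negbTE zx] := eqVneq z x; first by rewrite !permE /=; do 9?rewrite /= ?E ?eqxx.
  have [->|/negbTE zx'] := eqVneq z x'; first by rewrite !permE /= ; do 9?rewrite /= ?E ?eqxx.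
  have [->|/negbTE zy'] := eqVneq z y'; first by rewrite !permE /= ; do 9?rewrite /= ?E ?eqxx.
  have [->|/negbTE zy] := eqVneq z y; first by rewrite !permE /= ; do 9?rewrite /= ?E ?eqxx.
  by rewrite !permE /=; do 9?rewrite /= ?zx ?zx' ?zy ?zy'.
have up (u v : 'S_n) (i j : 'I_n) : i < j -> u i < u j -> v = (tperm i j * u)%g ->
    bruhat_le u v by move=> ? ? ->; exact: bruhat_stepI.
have tr : transitive (@bruhat_le n) by exact: connect_trans.
apply: (tr _ _ _ (up _ u1 x x' h1 _ erefl) _).
  by rewrite /u0 !permE /= ?E ?eqxx.
apply: (tr _ _ _ (up _ u2 y' y h3 _ erefl) _).
  by rewrite /u1 /u0 !permM !permE /=; do 9?rewrite /= ?E ?eqxx.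
apply: (tr _ _ _ (up _ u3 x y' x_y' _ erefl) _).
  by rewrite /u2 /u1 /u0 !permM !permE /=; do 9?rewrite /= ?E ?eqxx.
apply: (up _ _ x' y x'_y _ erefl).
by rewrite /u3 /u2 /u1 /u0 !permM !permE /=; do 9?rewrite /= ?E ?eqxx.
Qed.

(** [bruhat_le_up] yields a position z <= x' where the larger reflection has a value at least y'; as
    x' < d <= y', this forces z = x and y' <= y. Distinct commuting transpositions are disjoint, so
    both inequalities are strict. *)
Lemma bruhat_reflections d (x y x' y' : 'I_n) : x < d <= y -> x' < d <= y' ->
  bruhat_lt (tperm x' y') (tperm x y) -> commute (tperm x y) (tperm x' y') ->
  x < x' /\ y' < y.
Proof.
move=> /andP[xd dy] /andP[xd' dy'] /andP[ne le] com.
have [z [zx zy]] := bruhat_le_up (a := x'.+1) (b := y') le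
  (ex_intro _ x' (conj (ltnSn _) (leq_trans (leqnn _) (eq_leq (congr1 val (esym (tpermL x' y'))))))).
have xz : z = x /\ y' <= y.
  move: zy; case: tpermP => [-> //|e|_ _]; first by rewrite e in zx; lia.
  by lia.
case: xz => ez yy; rewrite ez ltnS in zx; rewrite !ltn_neqAle zx yy !andbT.
have key (i j k : 'I_n) : i != j -> i != k -> commute (tperm i j) (tperm i k) -> j = k.
  move=> ij ik /permP/(_ i); rewrite !permM !tpermL.
  have [-> //|jk] := eqVneq j k.
  by rewrite !tpermD // 1?eq_sym // => e; move: jk; rewrite e eqxx.
have nxy (i j : 'I_n) : i < d -> d <= j -> i != j.
  by move=> h1 h2; apply: contraTneq h1 => ->; rewrite -leqNgt.
split; apply/negP => /eqP/val_inj e; subst; case/negP: ne; apply/eqP.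
  by rewrite (key _ _ _ (nxy _ _ xd dy) (nxy _ _ xd dy') com).
rewrite (key y x x') // 1?eq_sym ?nxy //.
by rewrite (tpermC y x) (tpermC y x').
Qed.
End Bruhat.

(** * The effect of chains of reflections on ranks *)

Section ReflectionChains.
Variables (n d : nat) (w tau : 'S_n).
Hypothesis dn : d <= n.
Hypothesis htau : min_rep d tau.
Hypothesis hle : coset_le d tau w.

Local Notation a := (cnt d tau).
Local Notation r := (cnt d w).

Definition refl_pt (s : reflection n d) : nat * nat := (val (val s).1, val (val s).2).

Definition refl_pts (S : pred (reflection n d)) : pred (nat * nat) :=
  fun z => [exists s : reflection n d, S s && (refl_pt s == z)].

Lemma refl_pt_inj : injective refl_pt.
Proof.
move=> s t [/val_inj e1 /val_inj e2]; apply: val_inj.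
by rewrite [LHS]surjective_pairing [RHS]surjective_pairing; congr (_, _).
Qed.

Lemma refl_pt_grid s : (refl_pt s).1 < d <= (refl_pt s).2.
Proof. exact: valP s. Qed.

Definition bounded_chains (S : pred (reflection n d)) : Prop :=
  forall m c, sorted chain_rel c ->
  all (fun z => [&& refl_pts S z, z.1 < a m & ht d a m <= z.2]) c ->
  size c <= a m - r m.

(** Among the first d positions the value at x is replaced by that at y; the additive form avoids
    truncated subtraction. *)
Lemma cnt_reflect (u : 'S_n) (s : reflection n d) m :
  cnt d (refl_perm s * u)%g m + (u (val s).1 < m) = cnt d u m + (u (val s).2 < m).
Proof.
case/andP: (valP s); rewrite /refl_perm; case: (val s) => x y /= xd dy.
have split v : cnt d v m = #|[set z : 'I_n | (z < d) && (z != x) && (v z < m)]| + (v x < m).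
  rewrite /cnt (cardsD1 x) inE xd /= addnC; congr (_ + _); apply: eq_card => z.
  by rewrite !inE andbA [_ && (z < d)]andbC.
rewrite !split permM tpermL -!addnA [_ + (u x < m)]addnC; congr (_ + _).
apply: eq_card => z; rewrite !inE permM; case: (ltnP z d) => //= zd.
have [->|zx] //= := eqVneq z x.
have yz : y != z by apply: contraTneq zd => <-; rewrite -leqNgt.
by rewrite tpermD // eq_sym.
Qed.

Lemma chain_disjoint (s t : reflection n d) : chain_rel (refl_pt s) (refl_pt t) ->
  refl_perm s (val t).1 = (val t).1 /\ refl_perm s (val t).2 = (val t).2.
Proof.
have := refl_pt_grid s; have := refl_pt_grid t; rewrite /refl_pt /refl_perm /chain_rel.
case: (val s) (val t) => x y [x' y'] /= h1 h2 h3.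
by split; apply: tpermD; rewrite -(inj_eq val_inj) /=; lia.
Qed.

(** Reflections in a chain have disjoint supports, so each of them still sees the original values of
    [u]. *)
Lemma cnt_mul_chain (u : 'S_n) (c : seq (reflection n d)) m :
  sorted chain_rel [seq refl_pt s | s <- c] ->
  cnt d (mul_chain u c) m + count (fun s => u (val s).1 < m) c =
  cnt d u m + count (fun s => u (val s).2 < m) c.
Proof.
rewrite /mul_chain; elim: c u => [|s c IH] u //= hs.
have := IH (refl_perm s * u)%g (path_sorted hs).
have hc t : t \in c -> chain_rel (refl_pt s) (refl_pt t).
  move=> tc; have := order_path_min chain_rel_trans hs.
  by move=> /allP; apply; apply: map_f.
have e1 : count (fun t : reflection n d => (refl_perm s * u)%g (val t).1 < m) c =
    count (fun t : reflection n d => u (val t).1 < m) c.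
  by apply: eq_in_count => t /hc /chain_disjoint [e _]; rewrite permM e.
have e2 : count (fun t : reflection n d => (refl_perm s * u)%g (val t).2 < m) c =
    count (fun t : reflection n d => u (val t).2 < m) c.
  by apply: eq_in_count => t /hc /chain_disjoint [_ e]; rewrite permM e.
rewrite e1 e2 => e; have arith x p y q z p' q' :
  x + p = y + q -> y + p' = z + q' -> x + (p' + p) = z + (q' + q) by lia.
exact: arith e (cnt_reflect u s m).
Qed.

Lemma commute_chain (s t : reflection n d) : chain_rel (refl_pt s) (refl_pt t) ->
  commute (refl_perm s) (refl_perm t).
Proof.
move=> h; have [e1 e2] := chain_disjoint h.
have : (refl_perm t ^ refl_perm s)%g = refl_perm t.
  by rewrite {1 3}/refl_perm tpermJ e1 e2.
by move/conjg_fixP/commgP/commute_sym.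
Qed.

(* Comparing ranks at m, a reflection (x, y) lowers the rank of tau if
   tau x < m <= tau y, raises it if tau y < m <= tau x, and else preserves it;
   the first case means that it lies in the m-th rectangle. *)
Lemma S1_chain (S : pred (reflection n d)) : S1 w tau S <-> bounded_chains S.
Proof.
have ra : forall m, r m <= a m by apply/(coset_le_cnt dn).
split=> [h m c sc hc|h c sc cc hc].
  have [c' ec hc'] : exists2 c', c = [seq refl_pt s | s <- c'] & {in c', forall s, S s}.
    elim: c hc {sc} => [|z c IH] /=; first by exists [::].
    move=> /andP[/and3P[/existsP[s /andP[Ss /eqP es]] _ _] /IH [c' -> h']].
    by exists (s :: c'); rewrite /= ?es // => t; rewrite inE => /orP[/eqP ->|/h'].
  subst c; rewrite size_map.
  have /(coset_le_cnt dn) /(_ m) : coset_le d (mul_chain tau c') w.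
    apply: h => //; last first.
      move=> s t sc' tc'; have := sorted_chain_total sc (map_f refl_pt sc') (map_f refl_pt tc').
      case=> [/refl_pt_inj -> //|/commute_chain //|/commute_chain/commute_sym //].
    move: sc; rewrite sorted_map; apply: sub_sorted => s t.
    have := refl_pt_grid s; have := refl_pt_grid t; rewrite /refl_pt /relpre /chain_rel /refl_perm /=.
    move=> /andP[? ?] /andP[? ?] /andP[? ?]; apply: bruhat_nested => //; lia.
  have := cnt_mul_chain tau m sc.
  have -> : count (fun s : reflection n d => tau (val s).1 < m) c' = size c'.
    apply/eqP; rewrite -all_count; apply/allP => s sc'.
    have := allP hc _ (map_f refl_pt sc') => /and3P[_ /= h1 _].
    by have /andP[? ?] := refl_pt_grid s; rewrite (tau_lt_low htau).
  have -> : count (fun s : reflection n d => tau (val s).2 < m) c' = 0.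
    apply/eqP; rewrite -leqn0 leqNgt -has_count; apply/hasPn => s sc'.
    have := allP hc _ (map_f refl_pt sc') => /and3P[_ _ /= h1].
    by have /andP[? ?] := refl_pt_grid s; rewrite (tau_lt_high dn htau) // -leqNgt.
  by lia.
have sc' : sorted chain_rel [seq refl_pt s | s <- c].
  rewrite sorted_map; apply: (sub_in_sorted (P := mem c)) sc; last by apply/allP.
  move=> s t sc tc lt; apply/andP.
  exact: bruhat_reflections (valP s) (valP t) lt (cc s t sc tc).
apply/(coset_le_cnt dn) => m; have := cnt_mul_chain tau m sc'.
pose p (s : reflection n d) := ((refl_pt s).1 < a m) && (ht d a m <= (refl_pt s).2).
have e1 : count (fun s : reflection n d => tau (val s).1 < m) c =
    count (fun s => (refl_pt s).1 < a m) c.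
  by apply: eq_count => s; have /andP[? ?] := refl_pt_grid s; rewrite (tau_lt_low htau).
have e2 : count (fun s : reflection n d => tau (val s).2 < m) c =
    count (fun s => (refl_pt s).2 < ht d a m) c.
  by apply: eq_count => s; have /andP[? ?] := refl_pt_grid s; rewrite (tau_lt_high dn htau).
have : size [seq refl_pt s | s <- c & p s] <= a m - r m.
  apply: h.
    rewrite sorted_map sorted_filter -?sorted_map //.
    by move=> y x t; exact: chain_rel_trans.
  apply/allP => _ /mapP[s + ->]; rewrite mem_filter /p => /andP[/andP[-> ->] sc1].
  by rewrite !andbT; apply/existsP; exists s; rewrite hc //=.
rewrite size_map size_filter e1 e2.
(* A reflection with x < a m lies in the rectangle or has y < ht m. *)
have : count (fun s => (refl_pt s).1 < a m) c <= count p c + count (fun s => (refl_pt s).2 < ht d a m) c.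
  elim: (c) => //= s c0; rewrite /p; case: ltnP => _; case: (ltnP (refl_pt s).2) => _ /=; lia.
move=> q1 q2; have {q2} : count p c <= a m - r m by exact: q2.
by have := ra m; lia.
Qed.
End ReflectionChains.

Import GRing.Theory.

(** * The path families of the statement *)

(* Points are numbered from 1 in [startA] and [endE]. *)
Definition to_int (p : nat * nat) : int * int := (p.1.+1%:Z, p.2.+1%:Z)%R.

Lemma to_int_inj : injective to_int.
Proof. by move=> [x y] [x' y'] [-> ->]. Qed.

Lemma lattice_step_int p b : lattice_step (to_int p) b = to_int (nat_step p b).
Proof. by case: b; rewrite /lattice_step /to_int /=; congr (_, _); lia. Qed.

Lemma path_end_int p s : path_end (to_int p) s = to_int (walk_pt p s (size s)).
Proof.
rewrite /walk_pt take_size /path_end; elim: s p => //= b s IH p.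
by rewrite lattice_step_int IH.
Qed.

Lemma path_points_int p s z : reflect
  (exists k, k <= size s /\ z = to_int (walk_pt p s k)) (z \in path_points (to_int p) s).
Proof.
apply: (iffP idP) => [|[k [hk ->]]].
  rewrite /path_points; elim: s p => [|b s IH] p.
    by rewrite /= mem_seq1 => /eqP ->; exists 0; rewrite walk_pt0.
  rewrite in_cons => /orP[/eqP ->|/=]; first by exists 0; rewrite walk_pt0.
  by rewrite lattice_step_int => /IH [k [hk ->]]; exists k.+1.
rewrite /path_points; elim: s p k hk => [|b s IH] p [|k] hk; rewrite ?walk_pt0 ?mem_head //.
by rewrite in_cons /= lattice_step_int; apply/orP; right; exact: IH.
Qed.

Section PathFamilies.
Variables (n d : nat) (w tau : 'S_n).
Hypothesis d_gt0 : 0 < d.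
Hypothesis dn : d <= n.
Hypothesis hle : coset_le d tau w.

Local Notation a := (cnt d tau).
Local Notation r := (cnt d w).
Local Notation snk := (fun z : nat * nat => sink d a r z.2 z.1).

Let a0 := cnt0 d tau.
Let aS := cntS dn tau.
Let ra : forall m, r m <= a m. Proof. exact/(coset_le_cnt dn). Qed.

Lemma startA_int (l : 'I_d) : startA l = to_int (start l).
Proof. by rewrite /startA /to_int /start /=; have := ltn_ord l => ?; congr (_, _); lia. Qed.

Lemma kappaE (q : 'I_d) : kappa w tau q = d - a (coset_val d w q).
Proof.
rewrite /kappa; set M := coset_val d w q.
have -> : [set l : 'I_d | M < coset_val d tau l] = ~: [set l : 'I_d | l < a M].
  by apply/setP => l; rewrite !inE -coset_val_le // ltnNge.
by have := cardsC [set l : 'I_d | l < a M]; rewrite card_ord card_ord_lt ?cnt_le //; lia.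
Qed.

Lemma coset_val_cnt (q : 'I_d) k : coset_val d w q = k.+1 <-> r k <= q < r k.+1.
Proof.
have h m : (coset_val d w q <= m) = (q < r m) by exact: coset_val_le.
split=> [e|/andP[h1 h2]].
  by rewrite -h e leqnn andbT leqNgt -h e ltnn.
by apply/eqP; rewrite eqn_leq h h2 ltnNge h -leqNgt.
Qed.

Lemma endE_int (q : 'I_d) k : coset_val d w q = k.+1 ->
  endE w tau q = to_int (sink_pt d a k).
Proof.
move=> e; have /coset_val_cnt /andP[h1 h2] := e.
rewrite /endE /to_int /sink_pt kappaE e /=.
have := ra k.+1; have := a_ht d a0 aS k.+1; have := cnt_le dn tau k.+1.
by have := ht_ge d a0 aS k.+1 => *; congr (_, _); lia.
Qed.

Lemma endE_sink (q : 'I_d) : exists z, [/\ endE w tau q = to_int z, snk z &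
  z.1 + z.2 + 2 = d + coset_val d w q].
Proof.
have : 0 < coset_val d w q by rewrite ltnNge coset_val_le // cnt0.
case e : (coset_val d w q) => [|k] // _; have /coset_val_cnt /andP[h1 h2] := e.
exists (sink_pt d a k); split; first exact: endE_int.
  apply: sink_sink_pt => //; exact: leq_ltn_trans h1 h2.
have := ra k.+1; have := a_ht d a0 aS k.+1; have := ht_ge d a0 aS k.+1.
by rewrite /sink_pt /=; lia.
Qed.

Lemma sink_endE z : snk z -> exists q : 'I_d, endE w tau q = to_int z.
Proof.
move=> /(sinkP _ _ a0 aS) [k [h1 h2 h3]].
have rd : r k < d by exact: leq_trans h1 (cnt_le dn w _).
exists (Ordinal rd); rewrite (@endE_int _ k); last first.
  by apply/coset_val_cnt; rewrite /= leqnn.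
by congr to_int; rewrite /sink_pt h2 h3; case: (z).
Qed.

Lemma sink_lt_n z : snk z -> z.2 < n.
Proof.
move=> /(sinkP _ _ a0 aS) [k [h1 h2 h3]].
have kn : k.+1 <= n by rewrite leqNgt; apply/negP => nk; move: h1; rewrite !cnt_max //; lia.
have := ht_mono d a0 aS kn; have := a_ht d a0 aS n; rewrite cnt_max //; lia.
Qed.

Definition words (P : {ffun 'I_d -> n.-bseq bool}) (l : 'I_d) : seq bool := P l.

Lemma mem_path_families (P : {ffun 'I_d -> n.-bseq bool}) :
  reflect (is_family snk (words P)) (P \in path_families d w tau).
Proof.
rewrite inE; have endp l : path_end (startA l) (P l) = to_int (fpt (words P) l (size (words P l))).
  by rewrite startA_int path_end_int.
apply: (iffP andP) => [[/existsP[sg /forallP hsg] /forallP hn]|[h1 h2 h3]].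
  split.
  - move=> l l' i j hi hj e; apply/eqP; apply: contraT => ne.
    have /forallP/(_ l')/implyP/(_ ne)/negP := hn l; case; apply/hasP.
    exists (to_int (fpt (words P) l' j)).
      by rewrite startA_int; apply/path_points_int; exists j.
    by rewrite /= startA_int; apply/path_points_int; exists i; rewrite -e.
  - move=> l; have := hsg l; rewrite endp => /eqP e.
    by have [z [ez hz _]] := endE_sink (sg l); move: hz; rewrite -(to_int_inj (etrans e ez)).
  - move=> z /sink_endE [q eq]; exists (sg^-1 q)%g; apply: to_int_inj.
    by rewrite -endp (eqP (hsg _)) permKV.
(* The permutation sends a path to the index of the sink in which it ends; it is injective because
   the paths are disjoint. *)
have ex l : [exists q : 'I_d, endE w tau q == to_int (fpt (words P) l (size (words P l)))].
  by have [q eq] := sink_endE (h2 l); apply/existsP; exists q; apply/eqP.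
pose f l := xchoose (existsP (ex l)).
have fE l : endE w tau (f l) = to_int (fpt (words P) l (size (words P l))).
  exact: eqP (xchooseP (existsP (ex l))).
have finj : injective f.
  move=> l l' e; have := fE l; rewrite e fE => /to_int_inj/esym; exact: h1.
split.
  by apply/existsP; exists (perm finj); apply/forallP => l; rewrite endp permE fE.
apply/forallP => l; apply/forallP => l'; apply/implyP => ne; apply/hasPn => z.
rewrite startA_int => /path_points_int [j [hj ->]]; apply/negP; rewrite /= startA_int.
move=> /path_points_int [i [hi /to_int_inj e]]; case/eqP: ne.
exact: (h1 l l' i j hi hj (esym e)).
Qed.

Section OneFamily.
Variable P : {ffun 'I_d -> n.-bseq bool}.
Hypothesis famP : is_family snk (words P).

Let slt : forall z, snk z -> z.1 < d. Proof. by move=> z; apply: sink_lt => // m; exact: cnt_le. Qed.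

Lemma fpt_grid l k : 0 < k <= size (words P l) ->
  exists s : reflection n d, refl_pt s = fpt (words P) l k.
Proof.
move=> hk; have /andP[k0 ks] := hk.
have h1 := fpt_lt slt famP ks; have h2 := fpt_ge slt famP hk.
have h3 : (fpt (words P) l k).2 < n.
  have [_ hs _] := famP; have := sink_lt_n (hs l).
  have := @walk_pt_mono (start l) (words P l) k (size (words P l)).
  rewrite ks leqnn => /(_ isT) [_]; exact: leq_ltn_trans.
have h4 := leq_trans h1 dn.
have h5 : ((Ordinal h4, Ordinal h3).1 < d) && (d <= (Ordinal h4, Ordinal h3).2) by rewrite h1.
by exists (exist (fun s : 'I_n * 'I_n => is_true ((s.1 < d) && (d <= s.2))) _ h5); rewrite /refl_pt /= -surjective_pairing.
Qed.

Lemma card_points (K : 'I_d -> seq nat) (A : {set reflection n d}) :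
  (forall l, uniq (K l)) -> (forall l k, k \in K l -> 0 < k <= size (words P l)) ->
  (forall s, s \in A <-> exists l k, k \in K l /\ fpt (words P) l k = refl_pt s) ->
  #|A| = \sum_l size (K l).
Proof.
move=> uK hK hA; pose pts := [seq fpt (words P) l k | l <- enum 'I_d, k <- K l].
have up : uniq pts.
  apply: allpairs_uniq_dep => [|l _|]; [exact: enum_uniq|exact: uK|].
  move=> _ _ /allpairsPdep[l [k [_ hk ->]]] /allpairsPdep[l' [k' [_ hk' ->]]] /= e.
  have /andP[_ h1] := hK _ _ hk; have /andP[_ h2] := hK _ _ hk'.
  by have [-> ->] := fpt_inj famP h1 h2 e.
have -> : #|A| = size [seq refl_pt s | s <- enum A] by rewrite size_map cardE.
have -> : \sum_l size (K l) = size pts.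
  by rewrite size_allpairs_dep sumnE big_map big_enum.
apply: perm_size; apply: uniq_perm => //.
  by rewrite map_inj_uniq ?enum_uniq //; exact: refl_pt_inj.
move=> z; apply/mapP/allpairsPdep => [[s]|[l [k [_ hk ->]]]].
  rewrite mem_enum => /hA [l [k [h1 h2]]] ->; exists l, k.
  by rewrite mem_enum h2.
have [s es] := fpt_grid (hK _ _ hk); exists s; last by rewrite es.
by rewrite mem_enum; apply/hA; exists l, k.
Qed.

Definition point_set : {set reflection n d} :=
  [set s | `[< on_family (words P) (refl_pt s) >]].

Definition turn_set : {set reflection n d} :=
  [set s | `[< turn (words P) (refl_pt s) >]].

Lemma card_point_set : #|point_set| = \sum_l size (words P l).
Proof.
rewrite (@card_points (fun l => iota 1 (size (words P l)))).
- by apply: eq_bigr => l _; rewrite size_iota.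
- by move=> l; exact: iota_uniq.
- by move=> l k; rewrite mem_iota; lia.
move=> s; rewrite inE; split=> [/asboolP[l [k [h1 h2]]]|[l [k [h1 h2]]]].
  exists l, k; rewrite mem_iota; split=> //; case: k h1 h2 => [|k] h1 h2; last by lia.
  have /andP[h3 h4] := refl_pt_grid s.
  by have := ltn_ord l; move: h4; rewrite -h2 /fpt walk_pt0 /=; lia.
by apply/asboolP; exists l, k; move: h1; rewrite mem_iota; split=> //; lia.
Qed.

Lemma card_turn_set : #|turn_set| = EN_family P.
Proof.
pose q s k := ~~ nth true s k && nth false s k.+1.
(* Past the end of the word either default makes [q] fail, so the last letter never begins a
   turn. *)
have qP s k : (k \in iota 0 (size s)) && q s k =
   [&& k.+1 < size s, ~~ nth false s k & nth false s k.+1].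
  rewrite /q mem_iota add0n /=; case: (ltnP k.+1 (size s)) => h.
    by rewrite (ltnW h) (set_nth_default false) // ltnW.
  by rewrite [nth false s k.+1]nth_default ?andbF.
rewrite (@card_points (fun l => [seq k.+1 | k <- iota 0 (size (words P l)) & q (words P l) k])).
- by apply: eq_bigr => l _; rewrite size_map size_filter.
- by move=> l; rewrite map_inj_uniq ?filter_uniq ?iota_uniq // => ? ? [].
- by move=> l _ /mapP[k + ->]; rewrite mem_filter andbC qP => /andP[? _]; lia.
move=> s; rewrite inE; split=> [/asboolP[l [k [h1 h2 h3 h4]]]|[l [k [h1 h2]]]].
  exists l, k.+1; split=> //; apply: map_f.
  by rewrite mem_filter andbC qP h1 h2.
move: h1 => /mapP[k' + ek]; rewrite mem_filter andbC qP => /and3P[h3 h4 h5].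
by apply/asboolP; exists l, k'; split=> //; rewrite -ek.
Qed.

(** Comparing coordinate sums at both ends, path l, counted from 0, has length i_sigma(l) + l - d.
    Summing over l removes sigma, and d^2 = 2 C(d,2) + d leaves the stated exponent. *)
Lemma card_point_set_coset :
  #|point_set| = (\sum_(l < d) coset_val d w l - 'C(d.+1, 2))%N.
Proof.
have /mem_path_families := famP; rewrite inE => /andP[/existsP[sg /forallP hsg] _].
have key (l : 'I_d) : size (words P l) + d = coset_val d w (sg l) + l.
  have := hsg l; rewrite startA_int path_end_int => /eqP.
  have [z [-> _ ez]] := endE_sink (sg l) => /to_int_inj e.
  have := walk_pt_sum (start l) (leqnn (size (words P l))).
  by rewrite e /=; have := ltn_ord l; lia.
have : \sum_(l < d) (size (words P l) + d) = \sum_(l < d) (coset_val d w (sg l) + l).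
  by apply: eq_bigr => l _; exact: key.
rewrite !big_split /= -card_point_set sum_nat_const card_ord.
have -> : \sum_(l < d) coset_val d w (sg l) = \sum_(l < d) coset_val d w l.
  by rewrite [RHS](reindex_inj (@perm_inj _ sg)).
rewrite -(big_mkord xpredT (fun l => l)) bin2_sum binS bin1.
have : 'C(d, 2).*2 = d * d.-1 by rewrite bin2 -[RHS]odd_double_half oddM; case: (d) => //= k; case: odd.
have : d * d = d * d.-1 + d by rewrite -mulnSr prednK.
have arith p q c u v : u = v + d -> c * 2 = v -> p + u = q + c -> p = q - (c + d) by lia.
by rewrite -muln2; exact: arith.
Qed.
End OneFamily.
End PathFamilies.

(** * The partition of the sets with (S1) into intervals *)

Section Intervals.
Variables (n d : nat) (w tau : 'S_n).
Hypothesis d_gt0 : 0 < d.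
Hypothesis dn : d <= n.
Hypothesis htau : min_rep d tau.
Hypothesis hle : coset_le d tau w.

Local Notation a := (cnt d tau).
Local Notation r := (cnt d w).
Local Notation snk := (fun z : nat * nat => sink d a r z.2 z.1).

Let a0 := cnt0 d tau.
Let aS := cntS dn tau.
Let an : a n = d := cnt_max dn tau (leqnn n).
Let r0 := cnt0 d w.
Let rS := cntS dn w.
Let rn : r n = d := cnt_max dn w (leqnn n).
Let ra : forall m, r m <= a m. Proof. exact/(coset_le_cnt dn). Qed.
Let slt : forall z, snk z -> z.1 < d.
Proof. by move=> z; apply: sink_lt => // m; exact: cnt_le. Qed.

Definition in_interval (S : {set reflection n d}) (P : {ffun 'I_d -> n.-bseq bool}) :=
  (turn_set P \subset S) && (S \subset point_set P).

Lemma interval_S1 (S : {set reflection n d}) P : P \in path_families d w tau -> in_interval S P ->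
  S1 w tau (mem S).
Proof.
move=> /(mem_path_families d_gt0 dn hle) famP /andP[_ /fintype.subsetP hS].
apply/(S1_chain dn htau hle) => m c sc hc.
apply: (family_chain d_gt0 a0 aS r0 rS ra famP sc) => z /(allP hc).
case/and3P=> /existsP[s /andP[sS /eqP <-]] h1 h2; split=> //.
by have := hS s sS; rewrite inE => /asboolP.
Qed.

Lemma compatible_interval (S : {set reflection n d}) P : P \in path_families d w tau ->
  in_interval S P <-> compatible snk (refl_pts (mem S)) (words P).
Proof.
move=> hP; have /(mem_path_families d_gt0 dn hle) famP := hP.
split=> [/andP[/fintype.subsetP h1 /fintype.subsetP h2]|[_ h1 h2]].
  split=> // z; last first.
    move=> /existsP[s /andP[sS /eqP <-]].
    by have := h2 s sS; rewrite inE => /asboolP.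
  move=> tz; have [l [k [hk1 _ _ e]]] := tz.
  have [|s es] := fpt_grid d_gt0 dn hle famP (l := l) (k := k.+1); first by exact: ltnW.
  apply/existsP; exists s; rewrite es e eqxx andbT; apply: h1.
  by rewrite inE; apply/asboolP; rewrite es e.
apply/andP; split; apply/fintype.subsetP => s.
  by rewrite inE => /asboolP/h1/existsP[t /andP[tS /eqP/refl_pt_inj <-]].
by move=> sS; rewrite inE; apply/asboolP/h2/existsP; exists s; apply/andP.
Qed.

Lemma interval_unique (S : {set reflection n d}) P Q :
  P \in path_families d w tau -> Q \in path_families d w tau ->
  in_interval S P -> in_interval S Q -> P = Q.
Proof.
move=> hP hQ /(compatible_interval _ hP) cP /(compatible_interval _ hQ) cQ.
by apply/ffunP => l; apply: val_inj; exact: (compatible_unique slt cP cQ).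
Qed.

Lemma interval_exists (S : {set reflection n d}) : S1 w tau (mem S) ->
  exists2 P, P \in path_families d w tau & in_interval S P.
Proof.
move=> /(S1_chain dn htau hle) hS.
have grid z : refl_pts (mem S) z -> z.1 < d <= z.2.
  by move=> /existsP[s /andP[_ /eqP <-]]; exact: refl_pt_grid.
have cF := flow_compatible d_gt0 a0 aS (cnt_le dn tau) r0 rS ra an rn grid hS.
have sz (l : 'I_d) : size (flow_family a r n (refl_pts (mem S)) l) <= n.
  exact: size_flow_walk.
pose P := [ffun l : 'I_d => Bseq (sz l)].
have eP : words P = flow_family a r n (refl_pts (mem S)).
  by apply: funext => l; rewrite /words ffunE.
have hP : P \in path_families d w tau.
  by apply/(mem_path_families d_gt0 dn hle); rewrite eP; case: cF.
by exists P => //; apply/(compatible_interval _ hP); rewrite eP.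
Qed.

Lemma interval_count (S : {set reflection n d}) :
  \sum_(P in path_families d w tau) in_interval S P = `[< S1 w tau (mem S) >].
Proof.
case: asboolP => [/interval_exists [P hP iP]|nS].
  rewrite (bigD1 P) //= iP big1 // => Q /andP[hQ neQ].
  case iQ : (in_interval S Q) => //; case/eqP: neQ.
  exact: interval_unique hQ hP iQ iP.
apply: big1 => P hP; case iP : (in_interval S P) => //; case: nS.
exact: interval_S1 hP iP.
Qed.
End Intervals.

Local Open Scope ring_scope.

(** * Generating functions *)

Section Series.
Variables (T : finType) (m : nat).

Definition supp (M : {ffun T -> 'I_m.+1}) : {set T} := [set t | (0 < M t)%N].

(** Multiplicities are bounded by m, so the polynomials agree with the power series only up to
    degree m. *)
Definition eq_mod_Xn (p q : {poly int}) : Prop := exists u, p = q + u * 'X^(m.+1).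

Lemma eq_mod_XnM p p' q q' :
  eq_mod_Xn p q -> eq_mod_Xn p' q' -> eq_mod_Xn (p * p') (q * q').
Proof.
move=> [u ->] [v ->]; exists (u * q' + (q + u * 'X^(m.+1)) * v).
by rewrite mulrDr mulrDl -!addrA !mulrDl !mulrA; congr (_ + (_ + _)); rewrite mulrAC.
Qed.

Lemma eq_mod_Xn_coef p q k : eq_mod_Xn p q -> (k <= m)%N -> p`_k = q`_k.
Proof. by move=> [u ->] km; rewrite coefD coefMXn ltnS km addr0. Qed.

Lemma geometric_mod : eq_mod_Xn ((\sum_(j < m.+1) 'X^j) * (1 - 'X)) 1.
Proof.
by exists (-1); rewrite mulrC -opprB mulNr -subrX1 opprB mulN1r.
Qed.

(** Multiplicities are chosen independently: an element of R contributes z/(1-z), one of F outside R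
    contributes 1/(1-z), any other 1. *)
Lemma interval_series (R F : {set T}) : R \subset F ->
  eq_mod_Xn ((\sum_(M : {ffun T -> 'I_m.+1} | (R \subset supp M) && (supp M \subset F))
      'X^(\sum_t M t)) * (1 - 'X) ^+ #|F|) ('X^#|R|).
Proof.
move=> RF.
pose Q (t : T) : pred 'I_m.+1 := fun j => ((t \in R) ==> (0 < j)%N) && ((0 < j)%N ==> (t \in F)).
have -> : \sum_(M : {ffun T -> 'I_m.+1} | (R \subset supp M) && (supp M \subset F))
      'X^(\sum_t M t) = \prod_t \sum_(j | Q t j) 'X^j :> {poly int}.
  rewrite bigA_distr_big_dep; apply: eq_big => [M|M _]; last by rewrite -prodrXr.
  apply/andP/familyP => [[/fintype.subsetP h1 /fintype.subsetP h2] t|h].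
    apply/andP; split; apply/implyP => ht.
      by have := h1 t ht; rewrite inE.
    by apply: h2; rewrite inE.
  split; apply/fintype.subsetP => t; have /andP[/implyP h1 /implyP h2] := h t.
    by move/h1; rewrite inE.
  by rewrite inE => /h2.
have -> : (1 - 'X) ^+ #|F| = \prod_t (if t \in F then 1 - 'X else 1) :> {poly int}.
  by rewrite -big_mkcond /= prodr_const.
have -> : 'X^#|R| = \prod_t (if t \in R then 'X else 1) :> {poly int}.
  by rewrite -big_mkcond /= prodr_const.
rewrite -big_split /=; apply: (big_ind2 eq_mod_Xn) => [||t _].
- by exists 0; rewrite mul0r addr0.
- by move=> p p' q q' h h'; exact: (eq_mod_XnM h h').
have all_pos : \sum_(j < m.+1) 'X^j = 1 + \sum_(j < m.+1 | (0 < j)%N) 'X^j :> {poly int}.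
  by rewrite (bigD1 ord0) //= expr0; congr (_ + _); apply: eq_bigl => j; rewrite lt0n.
case: (boolP (t \in R)) => tR.
  rewrite (fintype.subsetP RF t tR).
  have -> : \sum_(j | Q t j) 'X^j = \sum_(j < m.+1 | (0 < j)%N) 'X^j :> {poly int}.
    by apply: eq_bigl => j; rewrite /Q tR (fintype.subsetP RF t tR) implybT andbT.
  have [u hu] := geometric_mod; exists u.
  by move: hu; rewrite all_pos mulrDl mul1r => /(canRL (addKr _)) ->; rewrite opprB addrA subrK.
case: (boolP (t \in F)) => tF.
  rewrite (eq_bigl xpredT) => [|j]; first exact: geometric_mod.
  by rewrite /Q (negbTE tR) tF implybT.
exists 0; rewrite mul0r addr0 mulr1 (big_pred1 ord0) ?expr0 // => j.
by rewrite /Q (negbTE tR) (negbTE tF) implybF /= lt0n negbK.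
Qed.
End Series.

(** A denominator with constant term 1 lets the coefficients be solved for one after the other. *)
Lemma hilbert_series_inj (h h' : nat -> nat) (num den : {poly int}) :
  den`_0 = 1 -> hilbert_series_eq h num den -> hilbert_series_eq h' num den -> h =1 h'.
Proof.
move=> d0 H H'; elim/ltn_ind => m IH; have := H m; rewrite -(H' m) !big_ord_recr /= subnn d0 !mulr1.
rewrite (eq_bigr (fun k : 'I_m => (h' k)%:Z * den`_(m - k))) => [/addrI []//|k _].
by rewrite IH.
Qed.

Section MultisetSeries.
Variables (n d : nat) (w tau : 'S_n).
Hypothesis d_gt0 : (0 < d)%N.
Hypothesis dn : (d <= n)%N.
Hypothesis htau : min_rep d tau.
Hypothesis hle : coset_le d tau w.

Let S1_supp m (M : {ffun reflection n d -> 'I_m.+1}) : bool :=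
  `[< S1 w tau (mem (supp M)) >].

(** One type, with bound m, serves all k <= m, since a multiplicity never exceeds the
    cardinality. *)
Lemma card_S1_multisets m k : (k <= m)%N ->
  #|S1_multisets d w tau k| =
  #|[set M : {ffun reflection n d -> 'I_m.+1} | (\sum_s M s == k)%N && S1_supp M]|.
Proof.
move=> km; have km1 : (k.+1 <= m.+1)%N by [].
pose f (M : {ffun reflection n d -> 'I_k.+1}) : {ffun reflection n d -> 'I_m.+1} :=
  [ffun s => widen_ord km1 (M s)].
have f_inj : injective f.
  move=> M M' /ffunP e; apply/ffunP => s; have := e s; rewrite !ffunE.
  by move=> /(congr1 val) /= /val_inj.
have f_sum M : (\sum_s f M s)%N = (\sum_s M s)%N by apply: eq_bigr => s _; rewrite ffunE.
have f_S1 M : S1_supp (f M) = `[< S1 w tau (fun s => (0 < M s)%N) >].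
  rewrite /S1_supp; congr (`[< S1 w tau _ >]); apply: funext => s.
  by rewrite -[LHS]/(s \in supp (f M)) inE ffunE.
rewrite -(card_imset _ f_inj); apply: eq_card => M; rewrite inE.
apply/imsetP/andP => [[M' + ->]|[/eqP h1 h2]]; first by rewrite inE f_sum f_S1 => /andP.
have hM s : (M s < k.+1)%N by rewrite ltnS -h1 (bigD1 s) //= leq_addr.
have eM : M = f [ffun s => Ordinal (hM s)].
  by apply/ffunP => s; rewrite !ffunE; apply: val_inj.
by exists [ffun s => Ordinal (hM s)] => //; rewrite inE -f_S1 -f_sum -eM h2 h1 eqxx.
Qed.

Lemma S1_multisets_series :
  hilbert_series_eq (fun m => #|S1_multisets d w tau m|) (EN_poly d w tau)
    ((1 - 'X) ^+ (\sum_(l < d) coset_val d w l - 'C(d.+1, 2))%N).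
Proof.
move=> m; set N := (_ - _)%N.
pose tot : {poly int} := \sum_(M : {ffun reflection n d -> 'I_m.+1} | S1_supp M) 'X^(\sum_s M s)%N.
have tot_coef k : (k <= m)%N -> tot`_k = (#|S1_multisets d w tau k|)%:Z.
  move=> km; rewrite (card_S1_multisets km) coef_sum -natz -sum1_card natr_sum /=.
  rewrite [RHS](eq_bigl (fun M => S1_supp M && (\sum_s M s == k)%N)) => [|M]; last first.
    by rewrite inE andbC.
  rewrite [RHS]big_mkcondr; apply: eq_bigr => M _; rewrite coefXn eq_sym.
  by case: eqP.
(* Each multiset goes to the unique family whose interval contains its support. *)
have totE : tot = \sum_(P in path_families d w tau)
    \sum_(M : {ffun reflection n d -> 'I_m.+1} | in_interval (supp M) P) 'X^(\sum_s M s)%N.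
  under [RHS]eq_bigr do rewrite big_mkcond.
  rewrite exchange_big /= /tot big_mkcond; apply: eq_bigr => M _.
  under [RHS]eq_bigr do rewrite -mulrb.
  by rewrite sumrMnr interval_count // mulrb.
have : tot * (1 - 'X) ^+ N = \sum_(P in path_families d w tau)
    (\sum_(M : {ffun reflection n d -> 'I_m.+1} | in_interval (supp M) P)
       'X^(\sum_s M s)%N) * (1 - 'X) ^+ N by rewrite totE mulr_suml.
move/(congr1 (fun p : {poly int} => p`_m)); rewrite coefM coef_sum => e.
under eq_bigr => k _ do rewrite -tot_coef ?leq_ord //.
rewrite e /EN_poly coef_sum; apply: eq_bigr => P hP.
have /(mem_path_families d_gt0 dn hle) famP := hP.
(* N is |F(P)| and the number of turns is |R(P)|, so each summand is an instance of
   [interval_series]. *)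
rewrite /N -(card_point_set_coset d_gt0 dn hle famP) -(card_turn_set d_gt0 dn hle famP).
apply: (eq_mod_Xn_coef (m := m)) => //; apply: interval_series.
apply/fintype.subsetP => s; rewrite 2![s \in _]inE => /asboolP[l [k [h1 _ _ h2]]].
by apply/asboolP; exists l, k.+1; split=> //; exact: ltnW.
Qed.
End MultisetSeries.

(** * Comparison with the tangent cone *)

Theorem theorem2 (K : closedFieldType) (V : vectType K) (n d : nat)
    (F : nat -> {vspace V}) (w tau : 'S_n) (U : {vspace V})
    (hd : (1 <= d <= n)%N) (hV : \dim {:V} = n) (hF : complete_flag n F)
    (hw : min_rep d w) (htau : min_rep d tau) (hle : coset_le d tau w)
    (XU : schubert_variety F d w U) (CU : schubert_cell F d tau U) :
  (forall m : nat,
     tangent_cone_hilbert XU m = #|S1_multisets d w tau m|)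
  <->
  hilbert_series_eq (tangent_cone_hilbert XU)
    (EN_poly d w tau)
    ((1 - 'X) ^+ (\sum_(l < d) coset_val d w l - 'C(d.+1, 2))%N).
Proof.
have /andP[d_gt0 dn] := hd.
have series := S1_multisets_series d_gt0 dn htau hle.
split=> [h m|h].
  by under eq_bigr => k _ do rewrite h; exact: series.
apply: hilbert_series_inj h series.
by rewrite -horner_coef0 !hornerE expr1n.
Qed.
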